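(* Let $R$ be a commutative unital ring, $k\ge1$, $d_0,\dots,d_k\ge1$, let $N_0,\dots,N_k$ be $R$-modules, and let $\Omega^{(j)}\subseteq(R^{d_j})_{\mathrm{nc}}$, $j=0,\dots,k$, be right admissible nc sets. For $j=0,\dots,k$ and $\beta=1,\dots,d_j$ let $$F_{j,\beta}\in\mathcal T^{k+1}(\Omega^{(0)},\dots,\Omega^{(j-1)},\Omega^{(j)},\Omega^{(j)},\Omega^{(j+1)},\dots,\Omega^{(k)};N_{0,\mathrm{nc}},\dots,N_{j,\mathrm{nc}},R_{\mathrm{nc}},N_{j+1,\mathrm{nc}},\dots,N_{k,\mathrm{nc}}).$$ Then there exists $f\in\mathcal T^k(\Omega^{(0)},\dots,\Omega^{(k)};N_{0,\mathrm{nc}},\dots,N_{k,\mathrm{nc}})$ such that ${}_j\Delta_\beta f=F_{j,\beta}$ for all $j=0,\dots,k$ and $\beta=1,\dots,d_j$ if and only if ${}_i\Delta_\alpha F_{j,\beta}={}_{j+1}\Delta_\beta F_{i,\alpha}$ for all $0\le i\le j\le k$, $\alpha=1,\dots,d_i$, $\beta=1,\dots,d_j$. Furthermore, $f$ is uniquely determined up to a $k$-linear mapping: if $\tilde f$ is another such antiderivative, then there is a $k$-linear mapping $c:N_1\times\cdots\times N_k\to N_0$ such that $\tilde f(X^0,\dots,X^k)(Z^1,\dots,Z^k)=f(X^0,\dots,X^k)(Z^1,\dots,Z^k)+C(Z^1,\dots,Z^k)$, where for $X^j\in\Omega^{(j)}_{n_j}$, $Z^j\in N_j^{n_{j-1}\times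 n_j}$, the $(\alpha_0,\alpha_k)$ entry of $C(Z^1,\dots,Z^k)\in N_0^{n_0\times n_k}$ is $\sum_{\alpha_1=1}^{n_1}\cdots\sum_{\alpha_{k-1}=1}^{n_{k-1}}c(Z^1_{\alpha_0,\alpha_1},\dots,Z^k_{\alpha_{k-1},\alpha_k})$.
   Context: $R$ is a commutative unital ring; matrices over $R$ multiply matrices over an $R$-module in the usual way. For an $R$-module $M$, $M_{\mathrm{nc}}=\bigsqcup_{n\ge1}M^{n\times n}$. A subset $\Omega\subseteq M_{\mathrm{nc}}$ is an nc set if $X\oplus Y\in\Omega$ (block diagonal sum) whenever $X,Y\in\Omega$; $\Omega_n=\Omega\cap M^{n\times n}$. It is right admissible if for all $X\in\Omega_n$, $Y\in\Omega_m$, $Z\in M^{n\times m}$ there is an invertible $r\in R$ with $\begin{bmatrix}X&rZ\\ 0&Y\end{bmatrix}\in\Omega_{n+m}$. nc functions of order $k\ge1$ (here $\Omega^{(j)}\subseteq M_{j,\mathrm{nc}}$): $f\in\mathcal T^k(\Omega^{(0)},\dots,\Omega^{(k)};N_{0,\mathrm{nc}},\dots,N_{k,\mathrm{nc}})$ means that for $X^j\in\Omega^{(j)}_{n_j}$, $f(X^0,\dots,X^k):N_1^{n_0\times n_1}\times\cdots\times N_k^{n_{k-1}\times n_k}\to N_0^{n_0\times n_k}$ is $k$-linear over $R$, and $f$ respects intertwinings (equivalently, direct sums and similarities): for matrices $T$ over $R$ and all arguments of appropriate sizes, (i) $TX^0=\tilde X^0T$ implies $Tf(X^0,X^1,\dots,X^k)(Z^1,\dots,Z^k)=f(\tilde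 X^0,X^1,\dots,X^k)(TZ^1,Z^2,\dots,Z^k)$; (ii) for $0<j<k$, $TX^j=\tilde X^jT$ implies $f(\dots,X^j,\dots)(Z^1,\dots,Z^jT,Z^{j+1},\dots,Z^k)=f(\dots,\tilde X^j,\dots)(Z^1,\dots,Z^j,TZ^{j+1},\dots,Z^k)$; (iii) $TX^k=\tilde X^kT$ implies $f(\dots,X^k)(Z^1,\dots,Z^{k-1},Z^kT)=f(\dots,\tilde X^k)(Z^1,\dots,Z^k)T$. Difference-differential operators (right admissible nc sets). For $f$ of order $k\ge1$ and $0\le j\le k$, ${}_j\Delta f$ is the nc function of order $k+1$ in which the $j$-th point argument is replaced by two points $X^j_1,X^j_2\in\Omega^{(j)}$ and a matrix argument $Z$ over $M_j$ is inserted after $Z^j$; writing $P=\begin{bmatrix}X^j_1&Z\\ 0&X^j_2\end{bmatrix}$, it is determined by ${}_0\Delta f(X^0_1,X^0_2,X^1,\dots,X^k)(Z,Z^1,\dots,Z^k)=\begin{bmatrix}I&0\end{bmatrix}f(P,X^1,\dots,X^k)\left(\begin{bmatrix}0\\ Z^1\end{bmatrix},Z^2,\dots,Z^k\right)$; for $0<j<k$, ${}_j\Delta f(X^0,\dots,X^j_1,X^j_2,\dots,X^k)(Z^1,\dots,Z^j,Z,Z^{j+1},\dots,Z^k)=f(X^0,\dots,P,\dots,X^k)\left(Z^1,\dots,Z^{j-1},\begin{bmatrix}Z^j&0\end{bmatrix},\begin{bmatrix}0\\ Z^{j+1}\end{bmatrix},Z^{j+2},\dots,Z^k\right)$; ${}_k\Delta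 f(X^0,\dots,X^{k-1},X^k_1,X^k_2)(Z^1,\dots,Z^k,Z)=f(X^0,\dots,X^{k-1},P)(Z^1,\dots,Z^{k-1},\begin{bmatrix}Z^k&0\end{bmatrix})\begin{bmatrix}0\\ I\end{bmatrix}$. These are used when $P\in\Omega^{(j)}$; for general $Z$ one replaces $Z$ by $rZ$ with $r\in R$ invertible such that the block matrix lies in $\Omega^{(j)}$ and divides the result by $r$ (this is independent of $r$ and linear in $Z$). The operators ${}_i\Delta$ on functions of order $k+1$ are defined in the same way. Directional operators: when $M_j=R^{d_j}$ with standard basis $e_1,\dots,e_{d_j}$, ${}_j\Delta_\alpha f$ ($1\le\alpha\le d_j$) is the nc function obtained from ${}_j\Delta f$ by taking as inserted argument $Z=Ae_\alpha$ with $A$ a matrix over $R$ (the matrix over $R^{d_j}$ with entries $A_{ab}e_\alpha$): ${}_j\Delta_\alpha f(\cdots)(Z^1,\dots,Z^j,A,Z^{j+1},\dots,Z^k)={}_j\Delta f(\cdots)(Z^1,\dots,Z^j,Ae_\alpha,Z^{j+1},\dots,Z^k)$. The same definition applies to functions of order $k+1$; e.g. in ${}_i\Delta_\alpha F_{j,\beta}$ with $i\le j$ the $i$-th point argument lies in $\Omega^{(i)}$, and in ${}_{j+1}\Delta_\beta F_{i,\alpha}$ the $(j+1)$-st point argument (counting from $0$) lies in $\Omega^{(j)}$. *)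

(* Defs.v *)
From HB Require Import structures.
From mathcomp Require Import all_boot all_order all_algebra.
From mathcomp Require Import boolp classical_sets.

Set Implicit Arguments.
Unset Strict Implicit.
Unset Printing Implicit Defensive.

Import GRing.Theory.

Local Open Scope classical_set_scope.
Local Open Scope ring_scope.

(* [comPzRingType] includes the zero ring.  There is no library product of a
   matrix over R with a matrix over an R-module, hence [lmulmx], [rmulmx] and
   [scalemod]. *)

Section ModuleMatrices.
Variables (R : comPzRingType) (M : lmodType R).

Definition lmulmx m n p (T : 'M[R]_(m, n)) (Z : 'M[M]_(n, p)) : 'M[M]_(m, p) :=
  \matrix_(i, j) \sum_l T i l *: Z l j.

Definition rmulmx m n p (Z : 'M[M]_(m, n)) (T : 'M[R]_(n, p)) : 'M[M]_(m, p) :=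
  \matrix_(i, j) \sum_l T l j *: Z i l.

Definition scalemod m n (r : R) (Z : 'M[M]_(m, n)) : 'M[M]_(m, n) :=
  map_mx (fun z => r *: z) Z.

(* A subset of M_nc is the family of its square-matrix parts.  The size is
   unrestricted in the type; [is_ncset] excludes the empty matrix. *)
Definition ncsub : Type := forall n, set 'M[M]_n.

Definition is_ncset (Om : ncsub) : Prop :=
  (forall n (X : 'M[M]_n), Om n X -> (0 < n)%N) /\
  (forall n m (X : 'M[M]_n) (Y : 'M[M]_m), Om n X -> Om m Y ->
     Om (n + m)%N (block_mx X 0 0 Y)).

Definition right_admissible (Om : ncsub) : Prop :=
  forall n m (X : 'M[M]_n) (Y : 'M[M]_m) (Z : 'M[M]_(n, m)),
    Om n X -> Om m Y ->
    exists r r' : R,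
      r * r' = 1 /\ Om (n + m)%N (block_mx X (scalemod r Z) 0 Y).

(* An invertible scalar (with its inverse) that brings the upper triangular
   block matrix into Om, when there is one. *)
Definition adm_scalar (Om : ncsub) n m
    (X : 'M[M]_n) (Y : 'M[M]_m) (Z : 'M[M]_(n, m)) : R * R :=
  xget (1, 1) [set r : R * R |
    r.1 * r.2 = 1 /\ Om (n + m)%N (block_mx X (scalemod r.1 Z) 0 Y)].

End ModuleMatrices.

Section NCFunctions.
Variable R : comPzRingType.

(* The data (d_j, Omega^(j), N_j) attached to one point argument, where
   Omega^(j) is a subset of (R^{d_j})_nc. *)
Record slot := Slot {
  sdim : nat;
  sdom : ncsub 'rV[R]_sdim;
  smod : lmodType R
}.

Definition slot0 : slot := @Slot 0 (fun _ => set0) R^o.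

Local Notation sd s j := (sdim (nth slot0 s j)).

(* The type of a function of order k is described by its k+1 slots.  Arguments
   come in the order X^0, X^1, Z^1, X^2, Z^2, ..., X^k, Z^k, so that a function
   may be partially applied.  [tail C n s] is the type of what remains once the
   last point received has size n and the slots s are still to come; C m is the
   type of the values when X^k has size m. *)
Fixpoint tail (C : nat -> Type) (n : nat) (s : seq slot) : Type :=
  match s with
  | [::] => C n
  | x :: s' => forall m, 'M['rV[R]_(sdim x)]_m -> 'M[smod x]_(n, m) ->
               tail C m s'
  end.

Definition vals (N : lmodType R) (n0 : nat) : nat -> Type :=
  fun n => 'M[N]_(n0, n).

(* Functions are total; all the conditions below only concern points taken in
   the domains.  The module in slot 0 is that of the values. *)
Definition ncfun (s : seq slot) : Type :=
  match s with
  | [::] => unit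
  | x :: s' => forall n0, 'M['rV[R]_(sdim x)]_n0 -> tail (vals (smod x) n0) n0 s'
  end.

Fixpoint tail_eq C n s : tail C n s -> tail C n s -> Prop :=
  match s with
  | [::] => fun f g => f = g
  | x :: s' => fun f g => forall m X Z, @sdom x m X ->
               tail_eq (f m X Z) (g m X Z)
  end.

Fixpoint post C C' (h : forall m, C m -> C' m) n s :
    tail C n s -> tail C' n s :=
  match s with
  | [::] => fun f => h n f
  | x :: s' => fun f m X Z => post h (f m X Z)
  end.

Fixpoint post2 C1 C2 C' (h : forall m, C1 m -> C2 m -> C' m) n s :
    tail C1 n s -> tail C2 n s -> tail C' n s :=
  match s with
  | [::] => fun f g => h n f g
  | x :: s' => fun f g m X Z => post2 h (f m X Z) (g m X Z)
  end.

Section Values.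
Variables (N : lmodType R) (n0 : nat).
Local Notation V := (vals N n0).

Definition tail_scale (r : R) n s : tail V n s -> tail V n s :=
  @post V V (fun m (v : 'M[N]_(n0, m)) => scalemod r v) n s.

Definition tail_add n s : tail V n s -> tail V n s -> tail V n s :=
  @post2 V V V (fun m (u v : 'M[N]_(n0, m)) => u + v) n s.

Definition tail_lmul n1 (T : 'M[R]_(n1, n0)) n s :
    tail V n s -> tail (vals N n1) n s :=
  @post V (vals N n1) (fun m (v : 'M[N]_(n0, m)) => lmulmx T v) n s.

Fixpoint tail_sum p n s : ('I_p -> tail V n s) -> tail V n s :=
  match s return ('I_p -> tail V n s) -> tail V n s with
  | [::] => fun f => \sum_(i < p) (f i : 'M[N]_(n0, n))
  | x :: s' => fun f m X Z => tail_sum (fun i => f i m X Z)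
  end.

(* The next matrix argument Z is replaced by T Z; when no argument is left, the
   value is multiplied by T on the right. *)
Definition act n m (T : 'M[R]_(n, m)) s : tail V n s -> tail V m s :=
  match s return tail V n s -> tail V m s with
  | [::] => fun f => rmulmx (f : 'M[N]_(n0, n)) T
  | x :: s' => fun f p X Z => f p X (lmulmx T Z)
  end.

Fixpoint tail_linear n s : tail V n s -> Prop :=
  match s return tail V n s -> Prop with
  | [::] => fun _ => True
  | x :: s' => fun f =>
      (forall m X (a : R) (Z Z' : 'M[smod x]_(n, m)), sdom X ->
         tail_eq (f m X (scalemod a Z + Z'))
                 (tail_add (tail_scale a (f m X Z)) (f m X Z'))) /\
      (forall m X (Z : 'M[smod x]_(n, m)), sdom X -> tail_linear (f m X Z))
  end.

(* At each remaining point argument X^j, 0 < j: condition (ii) if j < k,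
   condition (iii) if j = k. *)
Fixpoint tail_intertwines n s : tail V n s -> Prop :=
  match s return tail V n s -> Prop with
  | [::] => fun _ => True
  | x :: s' => fun f =>
      (forall m m' (X : 'M_m) (X' : 'M_m') (T : 'M[R]_(m', m))
              (Z : 'M[smod x]_(n, m')),
         sdom X -> sdom X' -> lmulmx T X = rmulmx X' T ->
         tail_eq (f m X (rmulmx Z T)) (act T (f m' X' Z))) /\
      (forall m X (Z : 'M[smod x]_(n, m)), sdom X ->
         tail_intertwines (f m X Z))
  end.

End Values.

Definition nc_eq (s : seq slot) : ncfun s -> ncfun s -> Prop :=
  match s return ncfun s -> ncfun s -> Prop with
  | [::] => fun _ _ => True
  | x :: s' => fun f g => forall n0 X0, @sdom x n0 X0 ->
               tail_eq (f n0 X0) (g n0 X0)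
  end.

Definition nc_add (s : seq slot) : ncfun s -> ncfun s -> ncfun s :=
  match s return ncfun s -> ncfun s -> ncfun s with
  | [::] => fun _ _ => tt
  | x :: s' => fun f g n0 X0 => tail_add (f n0 X0) (g n0 X0)
  end.

(* Membership in T^k(Omega^(0), ..., Omega^(k); N_0, ..., N_k). *)
Definition is_ncfun (s : seq slot) : ncfun s -> Prop :=
  match s return ncfun s -> Prop with
  | [::] => fun _ => True
  | x :: s' => fun f =>
      [/\ forall n X, @sdom x n X -> tail_linear (f n X),
          forall n n' (X : 'M_n) (X' : 'M_n') (T : 'M[R]_(n', n)),
            sdom X -> sdom X' -> lmulmx T X = rmulmx X' T ->
            tail_eq (tail_lmul T (f n X)) (act T (f n' X'))
        & forall n X, @sdom x n X -> tail_intertwines (f n X)]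
  end.

(* The slots obtained when the j-th point is doubled and a matrix argument over
   L is inserted after Z^j. *)
Fixpoint ins (j : nat) (L : lmodType R) (s : seq slot) {struct s} :
    seq slot :=
  match s, j with
  | [::], _ => [::]
  | x :: s', 0%N => x :: Slot (@sdom x) L :: s'
  | x :: s', j'.+1 => x :: ins j' L s'
  end.

Lemma ins_ins (i j : nat) (L : lmodType R) (s : seq slot) : (i <= j)%N ->
  ins i L (ins j L s) = ins j.+1 L (ins i L s).
Proof.
elim: i j s => [|i IHi] [|j] [|x s] //= le_ij.
by congr (_ :: _); apply: IHi.
Qed.

Definition nc_cast (s s' : seq slot) (e : s = s') (f : ncfun s) : ncfun s' :=
  ecast t (ncfun t) e f.

(* The operators _jDelta.  Acting by [0; I] turns the next argument W into
   [0; W], or multiplies the value by [0; I] on the right if none is left. *)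
Fixpoint tail_delta (N : lmodType R) (n0 j n : nat) (s : seq slot)
    {struct s} :
    tail (vals N n0) n s ->
    tail (vals N n0) n (ins j 'rV[R]_(sd s j) s) :=
  match s, j return tail (vals N n0) n s ->
                    tail (vals N n0) n (ins j 'rV[R]_(sd s j) s) with
  | [::], _ => fun f => f
  | x :: s', 0%N => fun f m1 X1 Z1 m2 X2 Z =>
      let r := adm_scalar (@sdom x) X1 X2 Z in
      tail_scale r.2
        (act (col_mx 0 1%:M)
             (f (m1 + m2)%N (block_mx X1 (scalemod r.1 Z) 0 X2)
                (row_mx Z1 0)))
  | x :: s', j'.+1 => fun f m X Z => tail_delta j' (f m X Z)
  end.

Definition delta (j : nat) (s : seq slot) :
    ncfun s -> ncfun (ins j 'rV[R]_(sd s j) s) :=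
  match s, j return ncfun s -> ncfun (ins j 'rV[R]_(sd s j) s) with
  | [::], _ => fun f => f
  | x :: s', 0%N => fun f n1 X1 n2 X2 Z =>
      let r := adm_scalar (@sdom x) X1 X2 Z in
      tail_scale r.2
        (tail_lmul (row_mx 1%:M 0)
           (act (col_mx 0 1%:M)
              (f (n1 + n2)%N (block_mx X1 (scalemod r.1 Z) 0 X2))))
  | x :: s', j'.+1 => fun f n X => tail_delta j' (f n X)
  end.

(* Evaluation of the inserted matrix argument at the image of a matrix under an
   entrywise map phi. *)
Fixpoint tail_subst (C : nat -> Type) (L L' : lmodType R) (phi : L' -> L)
    (j n : nat) (s : seq slot) {struct s} :
    tail C n (ins j L s) -> tail C n (ins j L' s) :=
  match s, j return tail C n (ins j L s) -> tail C n (ins j L' s) with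
  | [::], _ => fun f => f
  | x :: s', 0%N => fun f m1 X1 Z1 m2 X2 A => f m1 X1 Z1 m2 X2 (map_mx phi A)
  | x :: s', j'.+1 => fun f m X Z => tail_subst phi (f m X Z)
  end.

Definition subst (L L' : lmodType R) (phi : L' -> L) (j : nat) (s : seq slot) :
    ncfun (ins j L s) -> ncfun (ins j L' s) :=
  match s, j return ncfun (ins j L s) -> ncfun (ins j L' s) with
  | [::], _ => fun f => f
  | x :: s', 0%N => fun f n1 X1 n2 X2 A => f n1 X1 n2 X2 (map_mx phi A)
  | x :: s', j'.+1 => fun f n X => tail_subst phi (f n X)
  end.

(* Directions are numbered from 0; only a < d is meaningful. *)
Definition basis_row (d a : nat) : 'rV[R]_d := \row_(c < d) (c == a :> nat)%:R.

Definition ddelta (j a : nat) (s : seq slot) (f : ncfun s) :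
    ncfun (ins j R^o s) :=
  subst (fun t : R^o => (t : R) *: basis_row (sd s j) a) (delta j f).

(* Curried maps from the product of the modules of s to N. *)
Fixpoint kmap (N : lmodType R) (s : seq slot) : Type :=
  match s with
  | [::] => N
  | x :: s' => smod x -> kmap N s'
  end.

(* h = a f + g, pointwise *)
Fixpoint kmap_comb (N : lmodType R) (s : seq slot) (a : R) :
    kmap N s -> kmap N s -> kmap N s -> Prop :=
  match s return kmap N s -> kmap N s -> kmap N s -> Prop with
  | [::] => fun f g h => h = a *: (f : N) + g
  | x :: s' => fun f g h => forall u, kmap_comb a (f u) (g u) (h u)
  end.

Fixpoint klinear (N : lmodType R) (s : seq slot) : kmap N s -> Prop :=
  match s return kmap N s -> Prop with
  | [::] => fun _ => True
  | x :: s' => fun c =>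
      (forall (a : R) (u v : smod x),
         kmap_comb a (c u) (c v) (c (a *: u + v))) /\
      (forall u, klinear (c u))
  end.

(* The matrix whose entry in row i and last column index b is the sum over the
   intermediate indices of c i (Z_{r i, b_1}) (Z'_{b_1, b_2}) ... (Z''_{b_l, b}),
   Z, Z', ..., Z'' being the matrix arguments to come. *)
Fixpoint path_sum (N : lmodType R) (n0 : nat) (x : slot) (s : seq slot)
    (n : nat) (r : 'I_n0 -> 'I_n) (c : 'I_n0 -> smod x -> kmap N s) :
    tail (vals N n0) n (x :: s) :=
  match s return ('I_n0 -> smod x -> kmap N s) -> tail (vals N n0) n (x :: s)
  with
  | [::] => fun c m X Z => \matrix_(i, b) c i (Z (r i) b)
  | y :: s' => fun c m X Z =>
      tail_sum (fun b : 'I_m =>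
        @path_sum N n0 y s' m (fun _ => b) (fun i => c i (Z (r i) b)))
  end c.

Definition kmap_of (s : seq slot) : Type :=
  match s with
  | [::] => unit
  | x :: s' => kmap (smod x) s'
  end.

Definition is_klinear (s : seq slot) : kmap_of s -> Prop :=
  match s return kmap_of s -> Prop with
  | [::] => fun _ => True
  | x :: s' => fun c => klinear c
  end.

(* The function (X^0, ..., X^k)(Z^1, ..., Z^k) |-> C(Z^1, ..., Z^k). *)
Definition nc_const (s : seq slot) : kmap_of s -> ncfun s :=
  match s return kmap_of s -> ncfun s with
  | [::] => fun _ => tt
  | [:: x] => fun c n0 X0 => \matrix_(i, b) (if i == b then c : smod x else 0)
  | x :: y :: s' => fun c n0 X0 =>
      path_sum (fun i : 'I_n0 => i) (fun _ => c)
  end.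

(* (d_j, Omega^(j), N_j) for j = 0, ..., k; the values of the families beyond k
   play no role. *)
Definition slots (k : nat) (d : nat -> nat)
    (Om : forall j, ncsub 'rV[R]_(d j)) (N : nat -> lmodType R) : seq slot :=
  mkseq (fun j => Slot (Om j) (N j)) k.+1.

End NCFunctions.

(* Main.v *)
Require Import Defs.
From mathcomp Require Import all_boot all_order all_algebra.
From mathcomp Require Import boolp classical_sets.

(* The operators are inverted through the coboundary identity: for an nc
   function f and a matrix S over R,
     f(.., X1, ..)(.., Z, S Z', ..) - f(.., X2, ..)(.., Z S, Z', ..)
       = jDelta f(.., X1, X2, ..)(.., Z, X1 S - S X2, Z', ..),
   because [I S] intertwines [X1, X1 S - S X2; 0, X2] with X1.  Conversely this
   identity for all S gives both the intertwining property and jDelta f = F_j.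
   Hence f is recovered from its values at one base point of each domain, by
   taking S among the matrix units E_(0,b) in the expansion
   Z = sum_b Z E_(b,0) E_(0,b); the closedness condition for i = j is the cocycle
   identity that makes the result satisfy the coboundary identity, and the one
   for i < j makes the corrections at distinct points compatible.  When all
   jDelta f vanish, the coboundary identity says that f is a sum over paths of
   one multilinear map. *)

Set Implicit Arguments.
Unset Strict Implicit.
Unset Printing Implicit Defensive.

Import GRing.Theory.
Local Open Scope ring_scope.

(** * Matrices over R times matrices over a module *)

(** Two difficulties shape the induction on the points. The first point is special: condition (i)
    multiplies values on the left, whereas at every other point T passes to a neighbouring argument
    or to the right of the value. An auxiliary row argument over R attached to X^0 removes the
    distinction, so the work is done for partially applied functions, by recursion on the remaining
    slots. Moreover, functions are total while the hypotheses concern only the domains. Identities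
    are therefore tested on single entries at arguments whose points lie in the domains, and
    operators are asked to be linear for this weak equality. Finally, the triangular point at which
    an operator evaluates contains an arbitrarily chosen invertible scalar; linearity in the
    inserted argument and the comparison of two such points rest on block diagonal intertwinings
    whose weights absorb the scalars. *)

Section ModuleMatrixTheory.
Variables (R : comPzRingType) (M : lmodType R).
Implicit Types (m n p q : nat) (a : R).

Lemma lmulmxA m n p q (T : 'M[R]_(m, n)) (S : 'M[R]_(n, p)) (Z : 'M[M]_(p, q)) :
  lmulmx T (lmulmx S Z) = lmulmx (T *m S) Z.
Proof.
apply/matrixP=> i j; rewrite !mxE.
under eq_bigr do rewrite mxE scaler_sumr.
rewrite exchange_big; apply: eq_bigr => l _; rewrite !mxE scaler_suml.
by apply: eq_bigr => l' _; rewrite scalerA.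
Qed.

Lemma rmulmxA m n p q (Z : 'M[M]_(m, n)) (T : 'M[R]_(n, p)) (S : 'M[R]_(p, q)) :
  rmulmx (rmulmx Z T) S = rmulmx Z (T *m S).
Proof.
apply/matrixP=> i j; rewrite !mxE.
under eq_bigr do rewrite mxE scaler_sumr.
rewrite exchange_big; apply: eq_bigr => l _; rewrite !mxE scaler_suml.
by apply: eq_bigr => l' _; rewrite scalerA mulrC.
Qed.

Lemma lrmulmxA m n p q (T : 'M[R]_(m, n)) (Z : 'M[M]_(n, p)) (S : 'M[R]_(p, q)) :
  lmulmx T (rmulmx Z S) = rmulmx (lmulmx T Z) S.
Proof.
apply/matrixP=> i j; rewrite !mxE.
under eq_bigr do rewrite mxE scaler_sumr.
rewrite exchange_big; apply: eq_bigr => l _; rewrite !mxE scaler_sumr.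
by apply: eq_bigr => l' _; rewrite !scalerA mulrC.
Qed.

Lemma lmulmx_scalar m n a (Z : 'M[M]_(m, n)) : lmulmx a%:M Z = scalemod a Z.
Proof.
apply/matrixP=> i j; rewrite !mxE (bigD1 i) //= big1 => [|l ne_li].
  by rewrite mxE eqxx addr0.
by rewrite mxE eq_sym (negPf ne_li) scale0r.
Qed.

Lemma rmulmx_scalar m n a (Z : 'M[M]_(m, n)) : rmulmx Z a%:M = scalemod a Z.
Proof.
apply/matrixP=> i j; rewrite !mxE (bigD1 j) //= big1 => [|l ne_lj].
  by rewrite mxE eqxx addr0.
by rewrite mxE (negPf ne_lj) scale0r.
Qed.

Lemma scalemod1 m n (Z : 'M[M]_(m, n)) : scalemod 1 Z = Z.
Proof. by apply/matrixP=> i j; rewrite !mxE scale1r. Qed.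

Lemma scalemodA m n a b (Z : 'M[M]_(m, n)) :
  scalemod a (scalemod b Z) = scalemod (a * b) Z.
Proof. by apply/matrixP=> i j; rewrite !mxE scalerA. Qed.

Lemma scalemodr0 m n a : scalemod a (0 : 'M[M]_(m, n)) = 0.
Proof. by apply/matrixP=> i j; rewrite !mxE scaler0. Qed.

Lemma lmul1mx m n (Z : 'M[M]_(m, n)) : lmulmx 1%:M Z = Z.
Proof. by rewrite lmulmx_scalar scalemod1. Qed.

Lemma rmulmx1 m n (Z : 'M[M]_(m, n)) : rmulmx Z 1%:M = Z.
Proof. by rewrite rmulmx_scalar scalemod1. Qed.

Lemma lmulmx_linearl m n p a (T S : 'M[R]_(m, n)) (Z : 'M[M]_(n, p)) :
  lmulmx (a *: T + S) Z = scalemod a (lmulmx T Z) + lmulmx S Z.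
Proof.
apply/matrixP=> i j; rewrite !mxE scaler_sumr -big_split; apply: eq_bigr => l _.
by rewrite !mxE scalerDl scalerA.
Qed.

Lemma lmulmx_linearr m n p a (T : 'M[R]_(m, n)) (Z W : 'M[M]_(n, p)) :
  lmulmx T (scalemod a Z + W) = scalemod a (lmulmx T Z) + lmulmx T W.
Proof.
apply/matrixP=> i j; rewrite !mxE scaler_sumr -big_split; apply: eq_bigr => l _.
by rewrite !mxE scalerDr !scalerA mulrC.
Qed.

Lemma rmulmx_linearr m n p a (Z : 'M[M]_(m, n)) (T S : 'M[R]_(n, p)) :
  rmulmx Z (a *: T + S) = scalemod a (rmulmx Z T) + rmulmx Z S.
Proof.
apply/matrixP=> i j; rewrite !mxE scaler_sumr -big_split; apply: eq_bigr => l _.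
by rewrite !mxE scalerDl scalerA.
Qed.

Lemma rmulmx_linearl m n p a (T : 'M[R]_(n, p)) (Z W : 'M[M]_(m, n)) :
  rmulmx (scalemod a Z + W) T = scalemod a (rmulmx Z T) + rmulmx W T.
Proof.
apply/matrixP=> i j; rewrite !mxE scaler_sumr -big_split; apply: eq_bigr => l _.
by rewrite !mxE scalerDr !scalerA mulrC.
Qed.

Lemma lmulmx0 m n p (T : 'M[R]_(m, n)) : lmulmx T (0 : 'M[M]_(n, p)) = 0.
Proof. by apply/matrixP=> i j; rewrite !mxE big1 // => l _; rewrite mxE scaler0. Qed.

Lemma lmul0mx m n p (Z : 'M[M]_(n, p)) : lmulmx (0 : 'M[R]_(m, n)) Z = 0.
Proof. by apply/matrixP=> i j; rewrite !mxE big1 // => l _; rewrite mxE scale0r. Qed.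

Lemma rmul0mx m n p (T : 'M[R]_(n, p)) : rmulmx (0 : 'M[M]_(m, n)) T = 0.
Proof. by apply/matrixP=> i j; rewrite !mxE big1 // => l _; rewrite mxE scaler0. Qed.

Lemma rmulmx0 m n p (Z : 'M[M]_(m, n)) : rmulmx Z (0 : 'M[R]_(n, p)) = 0.
Proof. by apply/matrixP=> i j; rewrite !mxE big1 // => l _; rewrite mxE scale0r. Qed.

Lemma lmulmxD m n p (T : 'M[R]_(m, n)) (Z W : 'M[M]_(n, p)) :
  lmulmx T (Z + W) = lmulmx T Z + lmulmx T W.
Proof. by rewrite -{1}[Z]scalemod1 lmulmx_linearr scalemod1. Qed.

Lemma lmulDmx m n p (T S : 'M[R]_(m, n)) (Z : 'M[M]_(n, p)) :
  lmulmx (T + S) Z = lmulmx T Z + lmulmx S Z.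
Proof. by rewrite -{1}[T]scale1r lmulmx_linearl scalemod1. Qed.

Lemma rmulmxD m n p (Z : 'M[M]_(m, n)) (T S : 'M[R]_(n, p)) :
  rmulmx Z (T + S) = rmulmx Z T + rmulmx Z S.
Proof. by rewrite -{1}[T]scale1r rmulmx_linearr scalemod1. Qed.

Lemma rmulDmx m n p (T : 'M[R]_(n, p)) (Z W : 'M[M]_(m, n)) :
  rmulmx (Z + W) T = rmulmx Z T + rmulmx W T.
Proof. by rewrite -{1}[Z]scalemod1 rmulmx_linearl scalemod1. Qed.

Lemma lmulmxB m n p (T : 'M[R]_(m, n)) (Z W : 'M[M]_(n, p)) :
  lmulmx T (Z - W) = lmulmx T Z - lmulmx T W.
Proof. by apply/(canRL (addrK _)); rewrite -lmulmxD subrK. Qed.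

Lemma rmulBmx m n p (T : 'M[R]_(n, p)) (Z W : 'M[M]_(m, n)) :
  rmulmx (Z - W) T = rmulmx Z T - rmulmx W T.
Proof. by apply/(canRL (addrK _)); rewrite -rmulDmx subrK. Qed.

Lemma lmulZmx m n p a (T : 'M[R]_(m, n)) (Z : 'M[M]_(n, p)) :
  lmulmx (a *: T) Z = scalemod a (lmulmx T Z).
Proof. by rewrite -[a *: T]addr0 lmulmx_linearl lmul0mx addr0. Qed.

Lemma lmulmxZ m n p a (T : 'M[R]_(m, n)) (Z : 'M[M]_(n, p)) :
  lmulmx T (scalemod a Z) = scalemod a (lmulmx T Z).
Proof. by rewrite -[scalemod a Z]addr0 lmulmx_linearr lmulmx0 addr0. Qed.

Lemma rmulmxZ m n p a (Z : 'M[M]_(m, n)) (T : 'M[R]_(n, p)) :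
  rmulmx Z (a *: T) = scalemod a (rmulmx Z T).
Proof. by rewrite -[a *: T]addr0 rmulmx_linearr rmulmx0 addr0. Qed.

Lemma rmulZmx m n p a (Z : 'M[M]_(m, n)) (T : 'M[R]_(n, p)) :
  rmulmx (scalemod a Z) T = scalemod a (rmulmx Z T).
Proof. by rewrite -[scalemod a Z]addr0 rmulmx_linearl rmul0mx addr0. Qed.

Lemma lmul_col_mx m1 m2 n p (T1 : 'M[R]_(m1, n)) (T2 : 'M[R]_(m2, n))
    (Z : 'M[M]_(n, p)) :
  lmulmx (col_mx T1 T2) Z = col_mx (lmulmx T1 Z) (lmulmx T2 Z).
Proof.
apply/matrixP=> i k; rewrite !mxE.
by case defi: (split i) => /[!mxE]; under eq_bigr do rewrite mxE defi.
Qed.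

Lemma rmul_col_mx m1 m2 n p (Z1 : 'M[M]_(m1, n)) (Z2 : 'M[M]_(m2, n))
    (T : 'M[R]_(n, p)) :
  rmulmx (col_mx Z1 Z2) T = col_mx (rmulmx Z1 T) (rmulmx Z2 T).
Proof.
apply/matrixP=> i k; rewrite !mxE.
by case defi: (split i) => /[!mxE]; under eq_bigr do rewrite mxE defi.
Qed.

Lemma lmul_mx_row m n p1 p2 (T : 'M[R]_(m, n)) (Z1 : 'M[M]_(n, p1))
    (Z2 : 'M[M]_(n, p2)) :
  lmulmx T (row_mx Z1 Z2) = row_mx (lmulmx T Z1) (lmulmx T Z2).
Proof.
apply/matrixP=> i k; rewrite !mxE.
by case defk: (split k) => /[!mxE]; under eq_bigr do rewrite mxE defk.
Qed.

Lemma rmul_mx_row m n p1 p2 (Z : 'M[M]_(m, n)) (T1 : 'M[R]_(n, p1))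
    (T2 : 'M[R]_(n, p2)) :
  rmulmx Z (row_mx T1 T2) = row_mx (rmulmx Z T1) (rmulmx Z T2).
Proof.
apply/matrixP=> i k; rewrite !mxE.
by case defk: (split k) => /[!mxE]; under eq_bigr do rewrite mxE defk.
Qed.

Lemma lmul_row_col m n1 n2 p (T1 : 'M[R]_(m, n1)) (T2 : 'M[R]_(m, n2))
    (Z1 : 'M[M]_(n1, p)) (Z2 : 'M[M]_(n2, p)) :
  lmulmx (row_mx T1 T2) (col_mx Z1 Z2) = lmulmx T1 Z1 + lmulmx T2 Z2.
Proof.
apply/matrixP=> i k; rewrite !mxE big_split_ord /=.
congr (_ + _); apply: eq_bigr => j _; first by rewrite row_mxEl col_mxEu.
by rewrite row_mxEr col_mxEd.
Qed.

Lemma rmul_row_col m n1 n2 p (Z1 : 'M[M]_(m, n1)) (Z2 : 'M[M]_(m, n2))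
    (T1 : 'M[R]_(n1, p)) (T2 : 'M[R]_(n2, p)) :
  rmulmx (row_mx Z1 Z2) (col_mx T1 T2) = rmulmx Z1 T1 + rmulmx Z2 T2.
Proof.
apply/matrixP=> i k; rewrite !mxE big_split_ord /=.
congr (_ + _); apply: eq_bigr => j _; first by rewrite row_mxEl col_mxEu.
by rewrite row_mxEr col_mxEd.
Qed.

Lemma scalemod_row_mx m n1 n2 a (Z1 : 'M[M]_(m, n1)) (Z2 : 'M[M]_(m, n2)) :
  scalemod a (row_mx Z1 Z2) = row_mx (scalemod a Z1) (scalemod a Z2).
Proof. exact: map_row_mx. Qed.

Lemma scalemod_col_mx m1 m2 n a (Z1 : 'M[M]_(m1, n)) (Z2 : 'M[M]_(m2, n)) :
  scalemod a (col_mx Z1 Z2) = col_mx (scalemod a Z1) (scalemod a Z2).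
Proof. exact: map_col_mx. Qed.

Lemma lmul_block m1 m2 n1 n2 p1 p2
    (A : 'M[R]_(m1, n1)) (B : 'M[R]_(m1, n2))
    (C : 'M[R]_(m2, n1)) (D : 'M[R]_(m2, n2))
    (X : 'M[M]_(n1, p1)) (Y : 'M[M]_(n1, p2))
    (Z : 'M[M]_(n2, p1)) (W : 'M[M]_(n2, p2)) :
  lmulmx (block_mx A B C D) (block_mx X Y Z W) =
  block_mx (lmulmx A X + lmulmx B Z) (lmulmx A Y + lmulmx B W)
           (lmulmx C X + lmulmx D Z) (lmulmx C Y + lmulmx D W).
Proof.
by rewrite lmul_col_mx !lmul_row_col !lmul_mx_row !add_row_mx.
Qed.

Lemma rmul_block m1 m2 n1 n2 p1 p2
    (X : 'M[M]_(m1, n1)) (Y : 'M[M]_(m1, n2))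
    (Z : 'M[M]_(m2, n1)) (W : 'M[M]_(m2, n2))
    (A : 'M[R]_(n1, p1)) (B : 'M[R]_(n1, p2))
    (C : 'M[R]_(n2, p1)) (D : 'M[R]_(n2, p2)) :
  rmulmx (block_mx X Y Z W) (block_mx A B C D) =
  block_mx (rmulmx X A + rmulmx Y C) (rmulmx X B + rmulmx Y D)
           (rmulmx Z A + rmulmx W C) (rmulmx Z B + rmulmx W D).
Proof.
by rewrite rmul_col_mx !rmul_row_col !rmul_mx_row !add_row_mx.
Qed.

Lemma lmul_row_block m n1 n2 p1 p2 (T1 : 'M[R]_(m, n1)) (T2 : 'M[R]_(m, n2))
    (X : 'M[M]_(n1, p1)) (Y : 'M[M]_(n1, p2))
    (Z : 'M[M]_(n2, p1)) (W : 'M[M]_(n2, p2)) :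
  lmulmx (row_mx T1 T2) (block_mx X Y Z W) =
  row_mx (lmulmx T1 X + lmulmx T2 Z) (lmulmx T1 Y + lmulmx T2 W).
Proof. by rewrite lmul_row_col !lmul_mx_row add_row_mx. Qed.

Lemma rmul_block_col m1 m2 n1 n2 p
    (X : 'M[M]_(m1, n1)) (Y : 'M[M]_(m1, n2))
    (Z : 'M[M]_(m2, n1)) (W : 'M[M]_(m2, n2))
    (T1 : 'M[R]_(n1, p)) (T2 : 'M[R]_(n2, p)) :
  rmulmx (block_mx X Y Z W) (col_mx T1 T2) =
  col_mx (rmulmx X T1 + rmulmx Y T2) (rmulmx Z T1 + rmulmx W T2).
Proof. by rewrite rmul_col_mx !rmul_row_col. Qed.

Lemma lmul_block_col m1 m2 n1 n2 p
    (A : 'M[R]_(m1, n1)) (B : 'M[R]_(m1, n2))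
    (C : 'M[R]_(m2, n1)) (D : 'M[R]_(m2, n2))
    (Z1 : 'M[M]_(n1, p)) (Z2 : 'M[M]_(n2, p)) :
  lmulmx (block_mx A B C D) (col_mx Z1 Z2) =
  col_mx (lmulmx A Z1 + lmulmx B Z2) (lmulmx C Z1 + lmulmx D Z2).
Proof. by rewrite lmul_col_mx !lmul_row_col. Qed.

Lemma rmul_row_block m n1 n2 p1 p2 (Z1 : 'M[M]_(m, n1)) (Z2 : 'M[M]_(m, n2))
    (A : 'M[R]_(n1, p1)) (B : 'M[R]_(n1, p2))
    (C : 'M[R]_(n2, p1)) (D : 'M[R]_(n2, p2)) :
  rmulmx (row_mx Z1 Z2) (block_mx A B C D) =
  row_mx (rmulmx Z1 A + rmulmx Z2 C) (rmulmx Z1 B + rmulmx Z2 D).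
Proof. by rewrite rmul_row_col !rmul_mx_row add_row_mx. Qed.

End ModuleMatrixTheory.

(** * Admissible scalars and linear maps on matrices over a module *)

Section AdmissibleScalars.
Variables (R : comPzRingType) (M : lmodType R).

(** Right admissibility makes the set of candidates nonempty, so the default (1, 1) of [xget] is
    never returned. *)
Lemma adm_scalarP (Om : ncsub M) n m (X : 'M[M]_n) (Y : 'M[M]_m) (Z : 'M[M]_(n, m)) :
    right_admissible Om -> Om n X -> Om m Y ->
  let r := adm_scalar Om X Y Z in
  r.1 * r.2 = 1 /\ Om (n + m)%N (block_mx X (scalemod r.1 Z) 0 Y).
Proof.
move=> adm OmX OmY; rewrite /adm_scalar; case: xgetP => [_ -> [] //|noneP].
by have [r [r' rP]] := adm n m X Y Z OmX OmY; case: (noneP (r, r')).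
Qed.

End AdmissibleScalars.

Section MatrixLinear.
Variables (R : comPzRingType) (M U : lmodType R) (m n : nat).

Definition mxlinear (phi : 'M[M]_(m, n) -> U) : Prop :=
  forall a Z W, phi (scalemod a Z + W) = a *: phi Z + phi W.

Variable phi : 'M[M]_(m, n) -> U.
Hypothesis phi_lin : mxlinear phi.

Lemma mxlinD Z W : phi (Z + W) = phi Z + phi W.
Proof. by rewrite -{1}[Z]scalemod1 phi_lin scale1r. Qed.

Lemma mxlin0 : phi 0 = 0.
Proof. by apply: (addrI (phi 0)); rewrite -mxlinD !addr0. Qed.

Lemma mxlinZ a Z : phi (scalemod a Z) = a *: phi Z.
Proof. by rewrite -[scalemod a Z]addr0 phi_lin mxlin0 addr0. Qed.

Lemma mxlin_sum I (r : seq I) (P : pred I) (Z : I -> 'M[M]_(m, n)) :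
  phi (\sum_(i <- r | P i) Z i) = \sum_(i <- r | P i) phi (Z i).
Proof. exact: (big_morph phi mxlinD mxlin0). Qed.

End MatrixLinear.

(** * Entrywise evaluation of partially applied functions *)

Section Evaluation.
Variable R : comPzRingType.
Implicit Types (s : seq (slot R)) (n : nat).

(** Membership of the points in their domains is part of the type, so that a quantifier over [args]
    ranges exactly over what [tail_eq] tests. The final component is the column of the entry that is
    read off. *)
Fixpoint args n s : Type :=
  match s with
  | [::] => 'I_n
  | x :: s' => {m : nat &
      ({X : 'M['rV[R]_(sdim x)]_m | sdom X} * 'M[smod x]_(n, m) * args m s')%type}
  end.

Variables (N : lmodType R) (n0 : nat).
Local Notation V := (vals N n0).

Fixpoint ev (i : 'I_n0) n s : args n s -> tail V n s -> N :=
  match s return args n s -> tail V n s -> N with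
  | [::] => fun b f => (f : 'M[N]_(n0, n)) i b
  | x :: s' => fun w f =>
      ev i (projT2 w).2 (f (projT1 w) (sval (projT2 w).1.1) (projT2 w).1.2)
  end.

Lemma tail_eqP n s (f g : tail V n s) :
  tail_eq f g <-> forall i w, ev i w f = ev i w g.
Proof.
elim: s n f g => [|x s IHs] n f g /=; first by split=> [-> //|]; move/matrixP.
split=> [eq_fg i [m [[[X dX] Z] w]] /=|eq_fg m X Z dX].
  exact: (IHs _ _ _).1 (eq_fg m X Z dX) i w.
by apply/IHs => i w; have := eq_fg i (existT _ m (exist _ X dX, Z, w)).
Qed.

Lemma ev_add n s i (w : args n s) (f g : tail V n s) :
  ev i w (tail_add f g) = ev i w f + ev i w g.
Proof. by elim: s n w f g => [|x s IHs] n w f g /=; rewrite ?mxE ?IHs. Qed.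

Lemma ev_scale n s i (w : args n s) a (f : tail V n s) :
  ev i w (tail_scale a f) = a *: ev i w f.
Proof. by elim: s n w f => [|x s IHs] n w f /=; rewrite ?mxE ?IHs. Qed.

Lemma ev_sum n s i (w : args n s) p (f : 'I_p -> tail V n s) :
  ev i w (tail_sum f) = \sum_k ev i w (f k).
Proof. by elim: s n w f => [|x s IHs] n w f /=; rewrite ?summxE ?IHs. Qed.

Definition evE := (ev_add, ev_scale, ev_sum).

Lemma tail_eq_refl n s (f : tail V n s) : tail_eq f f.
Proof. exact/tail_eqP. Qed.

Lemma tail_eq_sym n s (f g : tail V n s) : tail_eq f g -> tail_eq g f.
Proof. by move/tail_eqP=> eq_fg; apply/tail_eqP=> i w. Qed.

Lemma tail_eq_trans n s (f g h : tail V n s) :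
  tail_eq f g -> tail_eq g h -> tail_eq f h.
Proof.
by move=> /tail_eqP eq_fg /tail_eqP eq_gh; apply/tail_eqP=> i w; rewrite eq_fg.
Qed.

(** A relation between three tails rather than an equation: only the values of [h] on the domains
    are prescribed. *)
Definition tcomb n s a (f g h : tail V n s) : Prop :=
  forall i w, ev i w h = a *: ev i w f + ev i w g.

Lemma tcombP n s a (f g h : tail V n s) :
  tcomb a f g h <-> tail_eq h (tail_add (tail_scale a f) g).
Proof.
split=> [fgh|/tail_eqP fgh i w]; last by rewrite fgh !evE.
by apply/tail_eqP => i w; rewrite !evE fgh.
Qed.

End Evaluation.

Arguments evE {R N n0}.

Section LinearOperators.
Variables (R : comPzRingType) (N N' : lmodType R) (n0 n0' n n' : nat).
Variables (s s' : seq (slot R)).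

(* Linearity up to [tail_eq], hence in particular compatibility with it. *)
Definition tail_op_linear (Phi : tail (vals N n0) n s -> tail (vals N' n0') n' s') :=
  forall a f g h, tcomb a f g h -> tcomb a (Phi f) (Phi g) (Phi h).

Variable Phi : tail (vals N n0) n s -> tail (vals N' n0') n' s'.
Hypothesis Phi_lin : tail_op_linear Phi.

(** On the domains [f] is 1 times [g] plus a vanishing tail [z]; since z = - z + z there, linearity
    forces [Phi z] to vanish. *)
Lemma tail_op_eq f g : tail_eq f g -> tail_eq (Phi f) (Phi g).
Proof.
move/tail_eqP => eq_fg.
pose z := tail_scale 0 f.
have z0 i w : ev i w (Phi z) = 0.
  have z_comb : tcomb (-1) z z z by move=> i' w'; rewrite scaleN1r addNr evE scale0r.
  by rewrite (Phi_lin z_comb) scaleN1r addNr.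
have fg_comb : tcomb 1 g z f by move=> i w; rewrite evE scale1r scale0r addr0 eq_fg.
by apply/tail_eqP => i w; rewrite (Phi_lin fg_comb) scale1r z0 addr0.
Qed.

Lemma ev_op_eq i w f g :
  (forall j v, ev j v f = ev j v g) -> ev i w (Phi f) = ev i w (Phi g).
Proof. by move/tail_eqP/tail_op_eq/tail_eqP. Qed.

Lemma ev_op_add i w f g :
  ev i w (Phi (tail_add f g)) = ev i w (Phi f) + ev i w (Phi g).
Proof.
have -> := @Phi_lin 1 f g (tail_add f g); first by rewrite scale1r.
by move=> j v; rewrite !evE scale1r.
Qed.

Lemma ev_op_scale i w a f : ev i w (Phi (tail_scale a f)) = a *: ev i w (Phi f).
Proof.
(* Linearity is available only in the form a f + g, so a f is written (a - 1) f + f, which avoids a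
   zero tail. *)
have -> := @Phi_lin (a - 1) f f (tail_scale a f).
  by rewrite scalerBl scale1r subrK.
by move=> j v; rewrite evE scalerBl scale1r subrK.
Qed.

Lemma ev_op_sum i w p (f : 'I_p -> tail (vals N n0) n s) :
  ev i w (Phi (tail_sum f)) = \sum_k ev i w (Phi (f k)).
Proof.
elim: p f => [|p IHp] f.
  rewrite big_ord0 (@ev_op_eq _ _ _ (tail_scale 0 (tail_sum f))).
    by rewrite ev_op_scale scale0r.
  by move=> j v; rewrite !evE big_ord0 scale0r.
rewrite big_ord_recl -IHp -ev_op_add; apply: ev_op_eq => j v.
by rewrite !evE big_ord_recl.
Qed.

End LinearOperators.

(** * Linearity and intertwining for partially applied functions *)

Section Good.
Variables (R : comPzRingType) (N : lmodType R) (n0 : nat).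
Local Notation V := (vals N n0).
Implicit Types (s : seq (slot R)) (n : nat).

Definition tail_nc n s (f : tail V n s) : Prop :=
  tail_linear f /\ tail_intertwines f.

(** Linearity and intertwining recurse separately over the slots; merging them gives the single
    unfolding on which the inductions run. *)
Lemma tail_nc_cons n x s (f : tail V n (x :: s)) :
  tail_nc f <->
  [/\ forall m (X : 'M_m) i w, sdom X -> mxlinear (fun Z => ev i w (f m X Z)),
      forall m m' (X : 'M_m) (X' : 'M_m') (T : 'M[R]_(m', m)) Z,
        sdom X -> sdom X' -> lmulmx T X = rmulmx X' T ->
        tail_eq (f m X (rmulmx Z T)) (act T (f m' X' Z))
    & forall m (X : 'M_m) Z, sdom X -> tail_nc (f m X Z)].
Proof.
split.
  case=> /= -[f_lin fl] [f_int fi]; split=> //.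
    by move=> m X i w dX a Z W; move/tcombP: (f_lin m X a Z W dX).
  by move=> m X Z dX; split; [apply: fl | apply: fi].
case=> f_lin f_int f_nc; split; split=> //.
- by move=> m X a Z W dX; apply/tcombP=> i w; apply: f_lin.
- by move=> m X Z /(f_nc m X Z) [].
- by move=> m X Z /(f_nc m X Z) [].
Qed.

Lemma act_linear n m (T : 'M[R]_(n, m)) s :
  tail_op_linear (@act R N n0 n m T s).
Proof.
case: s => [|x s] a f g h fgh i w; last first.
  by case: w => p [[X Z] w]; apply: (fgh i (existT _ p (X, lmulmx T Z, w))).
rewrite /= !mxE scaler_sumr -big_split; apply: eq_bigr => l _ /=.
by move: (fgh i l) => /= ->; rewrite scalerDr !scalerA mulrC.
Qed.

Arguments act_linear {n m} T {s}.

(** Linearity in T comes from linearity of [f] in the argument T Z, or from the product with the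
    value if no argument is left. Scalars are viewed in the module [R^o] so that T is a matrix over
    a module. *)
Lemma ev_act_mxlinear n m s (f : tail V n s) i w : tail_nc f ->
  mxlinear (fun T : 'M[R^o]_(n, m) => ev i w (act (T : 'M[R]_(n, m)) f)).
Proof.
case: s f w => [|x s] f w; last first.
  case/tail_nc_cons=> f_lin _ _ a T S.
  case: w => p [[[X dX] Z] w] /=; rewrite -f_lin //; congr (ev _ _ (f _ _ _)).
  by rewrite -lmulZmx -lmulDmx; congr lmulmx; apply/matrixP=> k l; rewrite !mxE.
move=> _ a T S; rewrite /= !mxE scaler_sumr -big_split; apply: eq_bigr => l _ /=.
by rewrite !mxE scalerA -scalerDl.
Qed.

Lemma actA n m p (T : 'M[R]_(n, m)) (S : 'M[R]_(m, p)) s (f : tail V n s) :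
  tail_eq (act S (act T f)) (act (T *m S) f).
Proof.
case: s f => [|x s] f /=; first by rewrite rmulmxA.
by move=> q X Z dX; rewrite lmulmxA; apply: tail_eq_refl.
Qed.

Lemma act1 n s (f : tail V n s) : tail_eq (act 1%:M f) f.
Proof.
case: s f => [|x s] f /=; first by rewrite rmulmx1.
by move=> q X Z dX; rewrite lmul1mx; apply: tail_eq_refl.
Qed.

Lemma tail_nc_comb n s a (f g h : tail V n s) :
  tcomb a f g h -> tail_nc f -> tail_nc g -> tail_nc h.
Proof.
elim: s n f g h => // x s IHs n f g h fgh /tail_nc_cons[fl fi fn].
case/tail_nc_cons=> gl gi gn; apply/tail_nc_cons.
have fghX m (X : 'M_m) Z : sdom X -> tcomb a (f m X Z) (g m X Z) (h m X Z).
  by move=> dX i w; apply: (fgh i (existT _ m (exist _ X dX, Z, w))).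
split=> [m X i w dX b Z W|m m' X X' T Z dX dX' TX|m X Z dX]; last first.
- exact: IHs (fghX m X Z dX) (fn _ _ _ dX) (gn _ _ _ dX).
- apply/tail_eqP=> i w; rewrite (fghX _ _ _ dX) (act_linear T _ _ _ _ (fghX _ _ _ dX')).
  by congr (_ *: _ + _); apply/tail_eqP: i w; [apply: fi | apply: gi].
rewrite !fghX // fl // gl // !scalerDr !scalerA [b * a]mulrC.
by rewrite -!addrA; congr (_ + _); rewrite addrCA.
Qed.

Lemma tail_nc_eq n s (f g : tail V n s) : tail_eq f g -> tail_nc f -> tail_nc g.
Proof.
move/tail_eqP => eq_fg f_nc; apply: (@tail_nc_comb _ _ 0 f f) => // i w.
by rewrite scale0r add0r eq_fg.
Qed.

Lemma tail_nc_add n s (f g : tail V n s) :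
  tail_nc f -> tail_nc g -> tail_nc (tail_add f g).
Proof. by apply: (@tail_nc_comb _ _ 1) => i w; rewrite evE scale1r. Qed.

Lemma tail_nc_scale n s a (f : tail V n s) : tail_nc f -> tail_nc (tail_scale a f).
Proof.
move=> f_nc; apply: (@tail_nc_comb _ _ (a - 1) f f) => // i w.
by rewrite evE scalerBl scale1r subrK.
Qed.

Lemma tail_nc_sum n s p (f : 'I_p -> tail V n s) :
  (forall k, tail_nc (f k)) -> tail_nc (tail_sum f).
Proof.
elim: s n f => [//|x s IHs] n f f_nc; apply/tail_nc_cons; split=> /=.
- move=> m X i w dX a Z W; rewrite !evE scaler_sumr -big_split.
  by apply: eq_bigr => k _ /=; have /tail_nc_cons[/(_ _ _ i w dX)] := f_nc k.
- move=> m m' X X' T Z dX dX' TX; apply/tail_eqP=> i w.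
  rewrite evE (ev_op_sum (act_linear T)); apply: eq_bigr => k _.
  by apply/tail_eqP: i w; have /tail_nc_cons[_ + _] := f_nc k; apply.
by move=> m X Z dX; apply: IHs => k; have /tail_nc_cons[_ _] := f_nc k; apply.
Qed.

End Good.

Arguments act_linear {R N n0 n m} T {s}.

Section ActTheory.
Variables (R : comPzRingType) (N : lmodType R) (n0 : nat).
Local Notation V := (vals N n0).
Implicit Types (s : seq (slot R)) (n : nat).

Lemma scalemod_regular m n a (T : 'M[R]_(m, n)) :
  scalemod a (T : 'M[R^o]_(m, n)) = a *: T.
Proof. by apply/matrixP=> i j; rewrite !mxE. Qed.

Lemma ev_actZ n m s (f : tail V n s) a (T : 'M[R]_(n, m)) i w : tail_nc f ->
  ev i w (act (a *: T) f) = a *: ev i w (act T f).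
Proof.
by move=> f_nc; rewrite -scalemod_regular (mxlinZ (ev_act_mxlinear i w f_nc)).
Qed.

Lemma ev_actD n m s (f : tail V n s) (T S : 'M[R]_(n, m)) i w : tail_nc f ->
  ev i w (act (T + S) f) = ev i w (act T f) + ev i w (act S f).
Proof. by move=> f_nc; rewrite (mxlinD (ev_act_mxlinear i w f_nc)). Qed.

Lemma ev_act_scalar n s (f : tail V n s) a i w : tail_nc f ->
  ev i w (act a%:M f) = a *: ev i w f.
Proof.
move=> f_nc; rewrite -scalemx1 ev_actZ //; congr (_ *: _).
by have /tail_eqP -> := act1 f.
Qed.

Lemma ev_act_act n m p (T : 'M[R]_(n, m)) (S : 'M[R]_(m, p)) s (f : tail V n s)
    i w : ev i w (act S (act T f)) = ev i w (act (T *m S) f).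
Proof. by have /tail_eqP -> := actA T S f. Qed.

Lemma ev_act_eq n m (T : 'M[R]_(n, m)) s (f g : tail V n s) i w :
  tail_eq f g -> ev i w (act T f) = ev i w (act T g).
Proof. by move/tail_eqP => fg; apply: (ev_op_eq (act_linear T)). Qed.

Lemma tail_nc_act n m (T : 'M[R]_(n, m)) s (f : tail V n s) :
  tail_nc f -> tail_nc (act T f).
Proof.
case: s f => // x s f /tail_nc_cons[f_lin f_int f_nc]; apply/tail_nc_cons.
split=> /= [p X i w dX a Z W|p p' X X' S Z dX dX' SX|p X Z dX].
- by rewrite lmulmx_linearr f_lin.
- apply: tail_eq_trans (_ : tail_eq _ (act S (f p' X' (lmulmx T Z)))) _.
    by rewrite lrmulmxA; apply: f_int.
  exact: tail_eq_refl.
exact: f_nc.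
Qed.

End ActTheory.

(** * The operators jDelta *)

Section FirstDelta.
Variables (R : comPzRingType) (N : lmodType R) (n0 n : nat).
Variables (x : slot R) (s : seq (slot R)).
Variable g : tail (vals N n0) n (x :: s).

(** The case j = 0 of [tail_delta]; the operators at later points reduce to it by partial
    application. *)
Definition tdelta m1 (X1 : 'M_m1) (Z1 : 'M[smod x]_(n, m1)) m2 (X2 : 'M_m2) Z :
    tail (vals N n0) m2 s :=
  let r := adm_scalar (@sdom R x) X1 X2 Z in
  tail_scale r.2 (act (col_mx 0 1%:M)
    (g (block_mx X1 (scalemod r.1 Z) 0 X2) (row_mx Z1 0))).

Hypothesis g_nc : tail_nc g.

Lemma ev_arg_linear m (X : 'M_m) i w :
  sdom X -> mxlinear (fun Z => ev i w (g X Z)).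
Proof. by case/tail_nc_cons: g_nc => + _ _; apply. Qed.

Lemma tail_nc_arg m (X : 'M_m) Z : sdom X -> tail_nc (g X Z).
Proof. by case/tail_nc_cons: g_nc => _ _; apply. Qed.

Lemma tail_arg_rmul m m' (X : 'M_m) (X' : 'M_m') (T : 'M[R]_(m', m)) Z :
    sdom X -> sdom X' -> lmulmx T X = rmulmx X' T ->
  tail_eq (g X (rmulmx Z T)) (act T (g X' Z)).
Proof. by case/tail_nc_cons: g_nc => _ + _; apply. Qed.

Lemma tail_argZ m (X : 'M_m) a Z : sdom X ->
  tail_eq (g X (scalemod a Z)) (tail_scale a (g X Z)).
Proof.
by move=> dX; apply/tail_eqP=> i w; rewrite evE (mxlinZ (ev_arg_linear i w dX)).
Qed.

Hypotheses (x_nc : is_ncset (@sdom R x)) (x_adm : right_admissible (@sdom R x)).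

Lemma tail_nc_tdelta m1 (X1 : 'M_m1) Z1 m2 (X2 : 'M_m2) Z :
  sdom X1 -> sdom X2 -> tail_nc (tdelta X1 Z1 X2 Z).
Proof.
move=> dX1 dX2; apply/tail_nc_scale/tail_nc_act/tail_nc_arg.
by have [] := adm_scalarP Z x_adm dX1 dX2.
Qed.

(** The scalars r in P and q in P' are unrelated choices. Weighting T1 by q and T2 by r makes the
    block diagonal T intertwine P with P', since both off-diagonal blocks acquire the factor q r;
    invertibility then removes the weights. *)
Lemma tdelta_intertwines m1 m1' m2 m2' (X1 : 'M_m1) (X1' : 'M_m1')
    (X2 : 'M_m2) (X2' : 'M_m2') (T1 : 'M[R]_(m1', m1)) (T2 : 'M[R]_(m2', m2))
    Z1 Z Z' :
    sdom X1 -> sdom X1' -> sdom X2 -> sdom X2' ->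
    lmulmx T1 X1 = rmulmx X1' T1 -> lmulmx T2 X2 = rmulmx X2' T2 ->
    lmulmx T1 Z = rmulmx Z' T2 ->
  tail_eq (tdelta X1 (rmulmx Z1 T1) X2 Z) (act T2 (tdelta X1' Z1 X2' Z')).
Proof.
move=> dX1 dX1' dX2 dX2' TX1 TX2 TZ; rewrite /tdelta.
have := adm_scalarP Z x_adm dX1 dX2; have := adm_scalarP Z' x_adm dX1' dX2'.
set r := adm_scalar _ X1 X2 Z; set q := adm_scalar _ X1' X2' Z'.
case=> qK dP' [rK dP]; set P := block_mx _ _ _ X2 in dP *.
set P' := block_mx _ _ _ X2' in dP' *.
pose T := block_mx (q.1 *: T1) 0 0 (r.1 *: T2).
have TP : lmulmx T P = rmulmx P' T.
  rewrite lmul_block rmul_block !lmulmx0 !rmul0mx !lmul0mx !rmulmx0.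
  rewrite !lmulZmx !rmulmxZ !lmulmxZ !rmulZmx TX1 TX2 TZ !scalemodA.
  by rewrite !addr0 !add0r mulrC.
have gP : tail_eq (g P (scalemod q.1 (row_mx (rmulmx Z1 T1) 0)))
                  (act T (g P' (row_mx Z1 0))).
  apply: tail_eq_trans (tail_arg_rmul _ dP dP' TP).
  rewrite scalemod_row_mx rmul_row_col !rmul_mx_row !rmul0mx !rmulmx0 add_row_mx.
  by rewrite addr0 add0r rmulmxZ scalemodr0; apply: tail_eq_refl.
pose c p1 p2 : 'M[R]_(p1 + p2, p2) := col_mx 0 1%:M.
have gPc i w : q.1 *: ev i w (act (c m1 m2) (g P (row_mx (rmulmx Z1 T1) 0))) =
               r.1 *: ev i w (act T2 (act (c m1' m2') (g P' (row_mx Z1 0)))).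
  rewrite -(ev_op_scale (act_linear _)).
  rewrite -(ev_act_eq _ _ _ (tail_argZ q.1 (row_mx (rmulmx Z1 T1) 0) dP)).
  rewrite (ev_act_eq _ _ _ gP) !ev_act_act -ev_actZ; last exact: tail_nc_arg.
  congr (ev _ _ (act _ _)); rewrite mul_block_col mul_col_mx.
  by rewrite !mul0mx !mulmx0 mulmx1 mul1mx !add0r scale_col_mx scaler0.
apply/tail_eqP=> i w; rewrite (ev_op_scale (act_linear _)) evE.
have -> : r.2 = r.2 * q.2 * q.1 by rewrite -mulrA [q.2 * _]mulrC qK mulr1.
rewrite -scalerA gPc scalerA; congr (_ *: _).
by rewrite [r.2 * _]mulrC -mulrA [r.2 * _]mulrC rK mulr1.
Qed.

(** The scalar matrix a intertwines X2 with itself: this is [tdelta_intertwines] for T1 = I and T2 =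
    a I. *)
Lemma tdeltaZ m1 (X1 : 'M_m1) Z1 m2 (X2 : 'M_m2) a Z : sdom X1 -> sdom X2 ->
  tail_eq (tdelta X1 Z1 X2 (scalemod a Z)) (tail_scale a (tdelta X1 Z1 X2 Z)).
Proof.
move=> dX1 dX2; apply/tail_eqP=> i w; rewrite evE.
rewrite -(ev_act_scalar a i w (tail_nc_tdelta Z1 Z dX1 dX2)).
rewrite -{1}[Z1]rmulmx1; apply/tail_eqP: i w; apply: tdelta_intertwines => //.
- by rewrite lmul1mx rmulmx1.
- by rewrite lmulmx_scalar rmulmx_scalar.
by rewrite lmul1mx rmulmx_scalar.
Qed.

(* Additivity comes from comparing the points X2 and X2 (+) X2, through
   the row matrix argument [Z W]. *)
Lemma tdeltaD m1 (X1 : 'M_m1) Z1 m2 (X2 : 'M_m2) Z W : sdom X1 -> sdom X2 ->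
  tail_eq (tdelta X1 Z1 X2 (Z + W))
          (tail_add (tdelta X1 Z1 X2 Z) (tdelta X1 Z1 X2 W)).
Proof.
move=> dX1 dX2; pose X22 := block_mx X2 0 0 X2.
have dX22 : sdom X22 by apply: (x_nc).2.
(* The pairs (a, b) = (1, 1), (1, 0), (0, 1) express the sum and its two terms through one tail, and
   the action of the column is linear in the column. *)
have split_arg a b : tail_eq (tdelta X1 Z1 X2 (scalemod a Z + scalemod b W))
    (act (col_mx a%:M b%:M) (tdelta X1 Z1 X22 (row_mx Z W))).
  rewrite -{1}[Z1]rmulmx1; apply: tdelta_intertwines => //.
  - by rewrite lmul1mx rmulmx1.
  - rewrite lmul_col_mx rmul_block_col !rmul0mx addr0 add0r.
    by rewrite !lmulmx_scalar !rmulmx_scalar.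
  by rewrite lmul1mx rmul_row_col !rmulmx_scalar.
have D_nc := tail_nc_tdelta Z1 (row_mx Z W) dX1 dX22.
apply/tail_eqP=> i w; rewrite evE.
have /tail_eqP := split_arg 1 1; rewrite !scalemod1 => ->.
have -> : col_mx 1%:M 1%:M = col_mx 1%:M 0%:M + col_mx 0%:M 1%:M :> 'M[R]_(m2 + m2, m2).
  by rewrite add_col_mx -!raddfD /= addr0 add0r.
have scalemod0 (U : 'M['rV[R]_(sdim x)]_(m1, m2)) : scalemod 0 U = 0.
  by apply/matrixP=> k l; rewrite !mxE scale0r.
rewrite ev_actD //; congr (_ + _).
  by have /tail_eqP <- := split_arg 1 0; rewrite scalemod1 scalemod0 addr0.
by have /tail_eqP <- := split_arg 0 1; rewrite scalemod1 scalemod0 add0r.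
Qed.

Lemma ev_tdelta_linear m1 (X1 : 'M_m1) Z1 m2 (X2 : 'M_m2) i w :
  sdom X1 -> sdom X2 -> mxlinear (fun Z => ev i w (tdelta X1 Z1 X2 Z)).
Proof.
move=> dX1 dX2 a Z W; have /tail_eqP -> := tdeltaD Z1 (scalemod a Z) W dX1 dX2.
by rewrite evE; have /tail_eqP -> := tdeltaZ Z1 a Z dX1 dX2; rewrite evE.
Qed.

(* The row [I r S] intertwines [X1, r Z; 0, X2] with X1 exactly when
   Z = X1 S - S X2. *)
Lemma tdelta_coboundary m1 (X1 : 'M_m1) Z1 m2 (X2 : 'M_m2) (S : 'M[R]_(m1, m2)) i w :
    sdom X1 -> sdom X2 ->
  ev i w (tdelta X1 Z1 X2 (rmulmx X1 S - lmulmx S X2)) =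
  ev i w (act S (g X1 Z1)) - ev i w (g X2 (rmulmx Z1 S)).
Proof.
move=> dX1 dX2; set Z := rmulmx X1 S - _; rewrite /tdelta evE.
case: (adm_scalarP Z x_adm dX1 dX2).
set r := adm_scalar _ _ _ _ => rK dP; set P := block_mx _ _ _ _ in dP *.
pose T : 'M[R]_(m1, m1 + m2) := row_mx 1%:M (r.1 *: S).
pose E : 'M[R]_(m2, m1 + m2) := row_mx 0 1%:M.
have TP : lmulmx T P = rmulmx X1 T.
  rewrite lmul_row_block rmul_mx_row !lmul1mx lmulmx0 addr0 rmulmx1 lmulZmx rmulmxZ.
  by congr row_mx; apply/matrixP=> k l; rewrite !mxE scalerBr subrK.
have EP : lmulmx E P = rmulmx X2 E.
  by rewrite lmul_row_block rmul_mx_row !lmul0mx !lmul1mx rmulmx0 rmulmx1 !add0r.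
(* T leads from P to X1 and E from P to X2, so each term of this splitting moves the evaluation to
   one diagonal block. The factor r left over cancels against the division by r. *)
have split_row : row_mx Z1 0 = rmulmx Z1 T + scalemod (- r.1) (rmulmx (rmulmx Z1 S) E).
  rewrite !rmul_mx_row !rmulmx1 rmulmxZ rmulmx0 scalemod_row_mx scalemodr0 add_row_mx addr0.
  by congr row_mx; apply/matrixP=> k l; rewrite !mxE scaleNr subrr.
have gP0 : tail_eq (g P (row_mx Z1 0))
    (tail_add (act T (g X1 Z1)) (tail_scale (- r.1) (act E (g X2 (rmulmx Z1 S))))).
  apply/tail_eqP=> j v; rewrite split_row (mxlinD (ev_arg_linear j v dP)).
  rewrite (mxlinZ (ev_arg_linear j v dP)) !evE.
  have /tail_eqP -> := tail_arg_rmul Z1 dP dX1 TP.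
  by have /tail_eqP -> := tail_arg_rmul (rmulmx Z1 S) dP dX2 EP.
rewrite (ev_act_eq _ _ _ gP0) (ev_op_add (act_linear _)) (ev_op_scale (act_linear _)).
rewrite !ev_act_act !mul_row_col !mulmx0 ?mul0mx !mulmx1 !add0r.
rewrite ev_actZ; last exact: tail_nc_arg.
rewrite scaleNr -scalerBr scalerA mulrC rK scale1r.
by have /tail_eqP -> := act1 (g X2 (rmulmx Z1 S)).
Qed.

End FirstDelta.

(** * Directional operators *)

Section DirectionalDelta.
Variables (R : comPzRingType) (N : lmodType R) (n0 : nat).
Local Notation V := (vals N n0).
Local Notation sd s j := (sdim (nth (slot0 R) s j)).

Definition basis_mx d a m1 m2 (A : 'M[R^o]_(m1, m2)) : 'M['rV[R]_d]_(m1, m2) :=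
  map_mx (fun t : R^o => (t : R) *: basis_row R d a) A.

Definition coord_mx d (a : 'I_d) m1 m2 (Z : 'M['rV[R]_d]_(m1, m2)) :
  'M[R^o]_(m1, m2) := map_mx (fun z : 'rV[R]_d => z 0 a : R^o) Z.

Lemma sum_basis_coord d m1 m2 (Z : 'M['rV[R]_d]_(m1, m2)) :
  Z = \sum_(a < d) basis_mx d a (coord_mx a Z).
Proof.
apply/matrixP=> i j; rewrite summxE; apply/rowP=> k; rewrite summxE (bigD1 k) //=.
rewrite !mxE eqxx mulr1 big1 ?addr0 // => l ne_lk.
by rewrite !mxE eq_sym [_ == _ :> nat](negPf ne_lk) mulr0.
Qed.

Lemma coord_basis_mx d (a b : 'I_d) m1 m2 (A : 'M[R^o]_(m1, m2)) :
  coord_mx a (basis_mx d b A) = if a == b then A else 0.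
Proof.
case: (eqVneq a b) => [->|ne_ab]; apply/matrixP=> i j; rewrite !mxE.
  by rewrite eqxx mulr1.
by rewrite [_ == _ :> nat](negPf ne_ab) mulr0.
Qed.

Definition tail_ddelta (j a n : nat) (s : seq (slot R)) (f : tail V n s) :
    tail V n (ins j R^o s) :=
  tail_subst (fun t : R^o => (t : R) *: basis_row R (sd s j) a) (tail_delta j f).

Lemma tail_ddelta0 a n x s (f : tail V n (x :: s)) :
  tail_ddelta 0 a f =
  fun m1 X1 Z1 m2 X2 A => tdelta f X1 Z1 X2 (basis_mx (sdim x) a A).
Proof. by []. Qed.

Lemma tail_ddeltaS j a n x s (f : tail V n (x :: s)) :
  tail_ddelta j.+1 a f = fun m X Z => tail_ddelta j a (f m X Z).
Proof. by []. Qed.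

Fixpoint nc_slots (s : seq (slot R)) : Prop :=
  match s with
  | [::] => True
  | x :: s' => (is_ncset (@sdom R x) /\ right_admissible (@sdom R x)) /\ nc_slots s'
  end.

Lemma nc_slots_ins j L s : nc_slots s -> nc_slots (ins j L s).
Proof. by elim: s j => [|x s IHs] [|j] //= [x_nc s_nc]; split=> //; apply: IHs. Qed.

(** Linearity in the inserted argument reassembles the directional operators into the full one, to
    which the coboundary identity applies. *)
Lemma sum_tail_ddelta0 n x s (f : tail V n (x :: s)) m1 (X1 : 'M_m1) Z1 m2
    (X2 : 'M_m2) (S : 'M[R]_(m1, m2)) i w :
    nc_slots (x :: s) -> tail_nc f -> sdom X1 -> sdom X2 ->
  \sum_(a < sdim x) ev i w (tail_ddelta 0 a f m1 X1 Z1 m2 X2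
     (coord_mx a (rmulmx X1 S - lmulmx S X2))) =
  ev i w (act S (f m1 X1 Z1)) - ev i w (f m2 X2 (rmulmx Z1 S)).
Proof.
case=> -[x_nc x_adm] _ f_nc dX1 dX2; rewrite -tdelta_coboundary //.
rewrite [in RHS](sum_basis_coord (rmulmx X1 S - lmulmx S X2)).
exact: esym (mxlin_sum (ev_tdelta_linear f_nc x_nc x_adm Z1 i w dX1 dX2) _ _ _).
Qed.

(** The scalar is chosen from the points and Z, not from the tail, so all three tails are evaluated
    at the same triangular point, which admissibility places in the domain. *)
Lemma tcomb_tdelta n x s b (f g h : tail V n (x :: s)) m1 (X1 : 'M_m1) Z1 m2
    (X2 : 'M_m2) Z :
    right_admissible (@sdom R x) -> sdom X1 -> sdom X2 -> tcomb b f g h ->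
  tcomb b (tdelta f X1 Z1 X2 Z) (tdelta g X1 Z1 X2 Z) (tdelta h X1 Z1 X2 Z).
Proof.
move=> x_adm dX1 dX2 fgh i w; have [_ dP] := adm_scalarP Z x_adm dX1 dX2.
rewrite /tdelta !evE.
rewrite [b *: _]scalerA mulrC -scalerA -scalerDr; congr (_ *: _).
apply: act_linear => j v.
exact: (fgh j (existT _ _ (exist _ _ dP, row_mx Z1 0, v))).
Qed.

Lemma tail_ddelta_linear j a n s :
  nc_slots s -> tail_op_linear (@tail_ddelta j a n s).
Proof.
elim: s j n => [|x s IHs] j n; first by case: j => [|j] _ b f g h.
case=> -[x_nc x_adm] s_nc b f g h fgh i; case: j => [|j]; last first.
  case=> m [[[X dX] Z] w]; apply: (IHs j m s_nc) => j' v.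
  exact: (fgh j' (existT _ m (exist _ X dX, Z, v))).
case=> m1 [[[X1 dX1] Z1] [m2 [[[X2 dX2] A] w]]].
exact: (tcomb_tdelta Z1 (basis_mx (sdim x) a A) x_adm dX1 dX2 fgh i w).
Qed.

Lemma tail_ddelta_act j a n m (T : 'M[R]_(n, m)) s (f : tail V n s) :
  tail_eq (tail_ddelta j a (act T f)) (act T (tail_ddelta j a f)).
Proof.
case: s j f => [|x s] [|j] f //=; last by move=> *; apply: tail_eq_refl.
move=> m1 X1 Z1 _ m2 X2 A _; rewrite /tail_ddelta /= lmul_mx_row lmulmx0.
exact: tail_eq_refl.
Qed.

End DirectionalDelta.

(** Both sides are the double sum over b and c of S_(b,c) phi (Z E_(b,0)) (E_(0,c)). This lets S
    cross the factorization through the base point. *)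
Lemma sum_delta_balanced (R : comPzRingType) (M U : lmodType R) n p m1 m2
    (phi : 'M[M]_(n, p.+1) -> 'M[R^o]_(p.+1, m2) -> U)
    (Z : 'M[M]_(n, m1)) (S : 'M[R]_(m1, m2)) :
    (forall T, mxlinear (phi^~ T)) -> (forall W, mxlinear (phi W)) ->
  \sum_b phi (rmulmx Z (delta_mx b ord0)) (delta_mx ord0 b *m S) =
  \sum_c phi (rmulmx (rmulmx Z S) (delta_mx c ord0)) (delta_mx ord0 c).
Proof.
move=> linl linr.
have rowS b : delta_mx ord0 b *m S =
    \sum_c scalemod (S b c) (delta_mx ord0 c : 'M[R^o]_(p.+1, m2)).
  apply/matrixP=> i j; rewrite summxE !mxE (bigD1 b) //= [X in _ + X]big1.
    rewrite (bigD1 j) //= [X in _ = _ + X]big1 => [|c ne_cj].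
      rewrite !mxE !eqxx !andbT !addr0; case: eqP => _; rewrite ?mul0r ?mul1r.
        by rewrite [_ *: _]mulr1.
      by rewrite scaler0.
    by rewrite !mxE [j == c]eq_sym (negPf ne_cj) andbF scaler0.
  by move=> c ne_cb; rewrite !mxE (negPf ne_cb) andbF mul0r.
have colS c : rmulmx (rmulmx Z S) (delta_mx c ord0) =
    \sum_b scalemod (S b c) (rmulmx Z (delta_mx b (ord0 : 'I_p.+1))).
  apply/matrixP=> i j; rewrite summxE !mxE (bigD1 c) //= [X in _ + X]big1.
    rewrite addr0 !mxE scaler_sumr; apply: eq_bigr => b _; rewrite !mxE.
    rewrite (bigD1 b) //= [X in _ *: (_ + X)]big1 => [|l ne_lb].
      rewrite !mxE !eqxx !scalerA /= addr0 scalerA; congr (_ *: _).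
      exact: mulrC.
    by rewrite !mxE (negPf ne_lb) scale0r.
  by move=> l ne_lc; rewrite !mxE (negPf ne_lc) scale0r.
under eq_bigr do rewrite rowS (mxlin_sum (linr _)).
under [RHS]eq_bigr do rewrite colS (mxlin_sum (linl _)).
rewrite exchange_big; apply: eq_bigr => c _; apply: eq_bigr => b _ /=.
by rewrite (mxlinZ (linr _)) (mxlinZ (linl _)).
Qed.

(** * Existence of antiderivatives *)

Section FirstPrimitive.
Variables (R : comPzRingType) (N : lmodType R) (n0 n : nat).
Local Notation V := (vals N n0).
Variables (x : slot R) (s : seq (slot R)).
Local Notation xx := (Slot (@sdom R x) R^o).
Variable F0 : nat -> tail V n (x :: xx :: s).

(** The prescribed value at D of the full operator at the first point, assembled from its
    directional components. *)
Definition diff0 m1 (X1 : 'M_m1) Z1 m2 (X2 : 'M_m2) (D : 'M['rV[R]_(sdim x)]_(m1, m2)) :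
    tail V m2 s :=
  tail_sum (fun b : 'I_(sdim x) => F0 b X1 Z1 X2 (coord_mx b D)).

(* The value f(X)(W T) that the coboundary identity forces when f(Y) = A. *)
Definition prim_term p (Y : 'M_p) (A : 'M[smod x]_(n, p) -> tail V p s)
    m (X : 'M_m) W (T : 'M[R]_(p, m)) : tail V m s :=
  tail_add (act T (A W))
    (tail_scale (-1) (diff0 Y W X (rmulmx Y T - lmulmx T X))).

(** [A] is a constant of integration for the first point; the recursion on the later slots supplies
    it. *)
Definition prim p (Y : 'M_p.+1) (A : 'M[smod x]_(n, p.+1) -> tail V p.+1 s) :
    tail V n (x :: s) :=
  fun m X Z => tail_sum (fun b : 'I_m =>
    prim_term Y A X (rmulmx Z (delta_mx b ord0)) (delta_mx ord0 b)).

Hypothesis F0_nc : forall b, (b < sdim x)%N -> tail_nc (F0 b).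

Lemma coord_mx_linear a m1 m2 b (D D' : 'M['rV[R]_(sdim x)]_(m1, m2)) :
  coord_mx a (scalemod b D + D') = scalemod b (coord_mx a D) + coord_mx a D'.
Proof. by apply/matrixP=> i j; rewrite !mxE. Qed.

Lemma coord_mxZ a m1 m2 b (D : 'M['rV[R]_(sdim x)]_(m1, m2)) :
  coord_mx a (scalemod b D) = scalemod b (coord_mx a D).
Proof. by apply/matrixP=> i j; rewrite !mxE. Qed.

Lemma coord_mx_rmul a m1 m2 m3 (D : 'M['rV[R]_(sdim x)]_(m1, m2))
    (S : 'M[R]_(m2, m3)) :
  coord_mx a (rmulmx D S) = rmulmx (coord_mx a D) S.
Proof.
apply/matrixP=> i j; rewrite !mxE summxE; apply: eq_bigr => l _.
by rewrite !mxE.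
Qed.

Lemma coord_mx_lmul a m1 m2 m3 (D : 'M['rV[R]_(sdim x)]_(m2, m3))
    (S : 'M[R]_(m1, m2)) :
  coord_mx a (lmulmx S D) = lmulmx S (coord_mx a D).
Proof.
apply/matrixP=> i j; rewrite !mxE summxE; apply: eq_bigr => l _.
by rewrite !mxE.
Qed.

Lemma ev_diff0_linear_mid m1 (X1 : 'M_m1) Z1 m2 (X2 : 'M_m2) i w :
  sdom X1 -> sdom X2 -> mxlinear (fun D => ev i w (diff0 X1 Z1 X2 D)).
Proof.
move=> dX1 dX2 a D D'; rewrite !evE scaler_sumr -big_split; apply: eq_bigr => b _ /=.
by rewrite coord_mx_linear (ev_arg_linear (tail_nc_arg (F0_nc (ltn_ord b)) Z1 dX1)).
Qed.

Lemma ev_diff0_linear_left m1 (X1 : 'M_m1) m2 (X2 : 'M_m2) D i w :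
  sdom X1 -> sdom X2 -> mxlinear (fun Z1 => ev i w (diff0 X1 Z1 X2 D)).
Proof.
move=> dX1 dX2 a Z W; rewrite !evE scaler_sumr -big_split; apply: eq_bigr => b _ /=.
exact: (ev_arg_linear (F0_nc (ltn_ord b)) i
          (existT _ m2 (exist _ X2 dX2, coord_mx b D, w)) dX1).
Qed.

Lemma tail_nc_diff0 m1 (X1 : 'M_m1) Z1 m2 (X2 : 'M_m2) D :
  sdom X1 -> sdom X2 -> tail_nc (diff0 X1 Z1 X2 D).
Proof.
move=> dX1 dX2; apply: tail_nc_sum => b.
exact: (tail_nc_arg (tail_nc_arg (F0_nc (ltn_ord b)) Z1 dX1)).
Qed.

Hypothesis xs_nc : nc_slots (x :: s).

(* The case i = j = 0 of the closedness condition is a cocycle identity for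
   the differences X1 S - S X2. *)
Hypothesis F0_closed : forall a b, (a < sdim x)%N -> (b < sdim x)%N ->
  tail_eq (tail_ddelta 0 a (F0 b)) (tail_ddelta 1 b (F0 a)).

(** Closedness, summed over the coordinates of D = X1 T - T X2 and D' = X2 S - S X3, has a
    coboundary on either side: along T in the first point, along S in the second. The terms regroup
    because X1 (T S) - (T S) X3 = T D' + D S. *)
Lemma diff0_cocycle m1 (X1 : 'M_m1) W m2 (X2 : 'M_m2) m3 (X3 : 'M_m3)
    (T : 'M[R]_(m1, m2)) (S : 'M[R]_(m2, m3)) i w :
    sdom X1 -> sdom X2 -> sdom X3 ->
  ev i w (act S (diff0 X1 W X2 (rmulmx X1 T - lmulmx T X2))) +
    ev i w (diff0 X2 (rmulmx W T) X3 (rmulmx X2 S - lmulmx S X3)) =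
  ev i w (diff0 X1 W X3 (rmulmx X1 (T *m S) - lmulmx (T *m S) X3)).
Proof.
move=> dX1 dX2 dX3; set D := rmulmx X1 T - _.
pose D' : 'M['rV[R]_(sdim x)]_(m2, m3) := rmulmx X2 S - lmulmx S X3; rewrite -/D'.
have [x_ok s_ok] := xs_nc; have xxs_nc : nc_slots (xx :: s) by [].
have xxxs_nc : nc_slots (x :: xx :: s) by [].
pose wX (B : 'M[R^o]_(m2, m3)) : args m2 (xx :: s) :=
  existT _ m3 (exist _ X3 dX3, B, w).
have closedX (a b : 'I_(sdim x)) :
    ev i (wX (coord_mx b D')) (tail_ddelta 0 a (F0 b) m1 X1 W m2 X2 (coord_mx a D)) =
    ev i w (@tail_ddelta R N n0 0 b m1 (xx :: s) (F0 a X1 W)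
              m2 X2 (coord_mx a D) m3 X3 (coord_mx b D')).
  have /tail_eqP eqF := F0_closed (ltn_ord a) (ltn_ord b).
  exact: (eqF i (existT _ m1 (exist _ X1 dX1, W,
            existT _ m2 (exist _ X2 dX2, coord_mx a D, wX (coord_mx b D'))))).
have : \sum_b \sum_a _ = \sum_b \sum_a _ :=
  eq_bigr _ (fun b _ => eq_bigr _ (fun a _ => closedX a b)).
rewrite [RHS]exchange_big /=.
under eq_bigr => b _.
  rewrite (sum_tail_ddelta0 W T i (wX (coord_mx b D')) xxxs_nc) //; last exact: F0_nc.
  over.
under [RHS]eq_bigr => a _.
  rewrite (@sum_tail_ddelta0 R N n0 m1 xx s (F0 a X1 W) _ _ (coord_mx a D)
             _ _ S i w xxs_nc) //; last first.
    exact: (@tail_nc_arg R N n0 n x (xx :: s) (F0 a) (F0_nc (ltn_ord a)) m1 X1 W dX1).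
  over.
rewrite !sumrB /= => eq_sums.
rewrite /diff0 (ev_op_sum (act_linear S)) !evE.
have -> : rmulmx X1 (T *m S) - lmulmx (T *m S) X3 = lmulmx T D' + rmulmx D S.
  rewrite /D /D' lmulmxB rmulBmx lmulmxA rmulmxA lrmulmxA [RHS]addrC.
  by rewrite addrA subrK.
under [RHS]eq_bigr => b _.
  rewrite -[lmulmx T D']scalemod1 coord_mx_linear scalemod1.
  rewrite coord_mx_lmul coord_mx_rmul.
  rewrite (mxlinD (ev_arg_linear (tail_nc_arg (F0_nc (ltn_ord b)) W dX1) i w dX3)).
  over.
rewrite big_split /=; move/(canRL (subrK _)): eq_sums => ->.
by rewrite addrAC subrK.
Qed.

Variables (p : nat) (Y : 'M['rV[R]_(sdim x)]_p.+1).
Variable A : 'M[smod x]_(n, p.+1) -> tail V p.+1 s.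
Hypothesis dY : sdom Y.
Hypothesis A_lin : forall i w, mxlinear (fun W => ev i w (A W)).
Hypothesis A_nc : forall W, tail_nc (A W).

Lemma ev_prim_term_linear_left m (X : 'M_m) T i w :
  sdom X -> mxlinear (fun W => ev i w (prim_term Y A X W T)).
Proof.
move=> dX a W W'; rewrite !ev_add !ev_scale.
rewrite (ev_diff0_linear_left _ _ _ dY dX a W W').
have -> : ev i w (act T (A (scalemod a W + W'))) =
          a *: ev i w (act T (A W)) + ev i w (act T (A W')).
  by apply: act_linear => j v; apply: A_lin.
by rewrite !scalerDr !scalerA [a * -1]mulrC addrACA.
Qed.

Lemma ev_prim_term_linear_right m (X : 'M_m) W i w : sdom X ->
  mxlinear (fun T : 'M[R^o]_(_, m) => ev i w (prim_term Y A X W T)).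
Proof.
move=> dX a T S; rewrite !ev_add !ev_scale.
have -> : rmulmx Y (scalemod a T + S) - lmulmx (scalemod a T + S) X =
    scalemod a (rmulmx Y T - lmulmx T X) + (rmulmx Y S - lmulmx S X).
  rewrite scalemod_regular rmulmx_linearr lmulmx_linearl opprD addrACA.
  by congr (_ + _); apply/matrixP=> k l; rewrite !mxE scalerBr.
rewrite (ev_diff0_linear_mid _ _ _ dY dX) (ev_act_mxlinear i w (A_nc W)).
by rewrite !scalerDr !scalerA [a * -1]mulrC addrACA.
Qed.

(** [sum_delta_balanced] rewrites the value at X2 as a sum over the same index b as the value at X1,
    with E_(0,b) S in place of E_(0,b). The terms are then compared by the cocycle identity for Y,
    X1, X2 with T = E_(0,b). *)
Lemma prim_coboundary m1 (X1 : 'M_m1) Z m2 (X2 : 'M_m2) (S : 'M[R]_(m1, m2)) i w :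
    sdom X1 -> sdom X2 ->
  ev i w (act S (prim Y A X1 Z)) =
  ev i w (prim Y A X2 (rmulmx Z S)) +
    ev i w (diff0 X1 Z X2 (rmulmx X1 S - lmulmx S X2)).
Proof.
move=> dX1 dX2; rewrite (ev_op_sum (act_linear S)) ev_sum.
rewrite -(sum_delta_balanced (phi := fun W T => ev i w (prim_term Y A X2 W T))); first last.
- by move=> W; apply: ev_prim_term_linear_right.
- by move=> T; apply: ev_prim_term_linear_left.
set D := rmulmx X1 S - _.
have -> : ev i w (diff0 X1 Z X2 D) = \sum_b ev i w
    (diff0 X1 (rmulmx (rmulmx Z (delta_mx b ord0)) (delta_mx (ord0 : 'I_p.+1) b)) X2 D).
  rewrite -(mxlin_sum (ev_diff0_linear_left D i w dX1 dX2)).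
  congr (ev _ _ (diff0 _ _ _ _)).
  rewrite -[LHS]rmulmx1 mx1_sum_delta.
  rewrite (big_morph (rmulmx Z) (rmulmxD Z) (rmulmx0 _ Z)).
  by apply: eq_bigr => b _; rewrite rmulmxA mul_delta_mx.
rewrite -big_split; apply: eq_bigr => b _ /=; rewrite (ev_op_add (act_linear S)).
rewrite (ev_op_scale (act_linear S)) ev_act_act !ev_add !ev_scale -addrA.
congr (_ + _); rewrite -(diff0_cocycle _ _ _ i w dY dX1 dX2).
by rewrite scalerDr -addrA !scaleN1r addNr addr0.
Qed.

Lemma tail_nc_prim : tail_nc (prim Y A).
Proof.
apply/tail_nc_cons; split=> [m X i w dX a Z W|m m' X X' T Z dX dX' TX|m X Z dX].
- rewrite !ev_sum scaler_sumr -big_split; apply: eq_bigr => b _ /=.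
  by rewrite rmulmx_linearl ev_prim_term_linear_left.
- apply/tail_eqP=> i w; rewrite (prim_coboundary Z T i w dX' dX) TX subrr.
  by rewrite (mxlin0 (ev_diff0_linear_mid Z i w dX' dX)) addr0.
apply: tail_nc_sum => b; apply: tail_nc_add; first exact: tail_nc_act.
by apply: tail_nc_scale; apply: tail_nc_diff0.
Qed.

(** The operator evaluates at P and acts by S = [0; I]. In the coboundary identity between P and X2
    the term at X2 drops out, since [Z1 0] S = 0, and P S - S X2 = [r B e_b; 0] has only the
    coordinate b. Intertwining [F0 b] by [I; 0] finally replaces P by X1. *)
Lemma tail_ddelta0_prim b : (b < sdim x)%N ->
  tail_eq (tail_ddelta 0 b (prim Y A)) (F0 b).
Proof.
move=> lt_b m1 X1 Z1 dX1 m2 X2 B dX2; have [[_ x_adm] _] := xs_nc.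
apply/tail_eqP=> i w; rewrite tail_ddelta0 /tdelta ev_scale.
have [] := adm_scalarP (basis_mx (sdim x) b B) x_adm dX1 dX2.
set r := adm_scalar _ _ _ _ => rK dP; set P := block_mx _ _ _ _ in dP *.
rewrite (prim_coboundary _ _ i w dP dX2) rmul_row_col rmulmx0 rmul0mx addr0.
rewrite (mxlin0 (ev_arg_linear tail_nc_prim i w dX2)) add0r.
rewrite rmul_block_col !rmulmx1 !rmulmx0 !add0r.
rewrite lmul_col_mx lmul0mx lmul1mx opp_col_mx add_col_mx subr0 subrr.
have coordP (a : 'I_(sdim x)) :
    coord_mx a (col_mx (scalemod r.1 (basis_mx (sdim x) b B)) 0) =
    if a == Ordinal lt_b then scalemod r.1 (col_mx B 0 : 'M[R^o]_(m1 + m2, m2)) else 0.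
  have -> : col_mx (scalemod r.1 (basis_mx (sdim x) b B)) (0 : 'M_(m2, m2)) =
      scalemod r.1 (basis_mx (sdim x) (Ordinal lt_b) (col_mx B 0)).
    rewrite /basis_mx map_col_mx scalemod_col_mx; congr col_mx.
    by apply/matrixP=> k l; rewrite !mxE scale0r scaler0.
  rewrite coord_mxZ coord_basis_mx.
  by case: ifP => // _; rewrite scalemodr0.
rewrite ev_sum (bigD1 (Ordinal lt_b)) //= coordP eqxx big1 => [|a ne_a].
  rewrite addr0 (mxlinZ (ev_arg_linear (tail_nc_arg (F0_nc lt_b) _ dP) i w dX2)).
  rewrite scalerA mulrC rK scale1r.
  pose T : 'M[R]_(m1 + m2, m1) := col_mx 1%:M 0.
  have TX : lmulmx T X1 = rmulmx P T.
    by rewrite lmul_col_mx rmul_block_col !rmulmx1 !rmulmx0 lmul1mx lmul0mx !addr0.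
  have /tail_eqP eqF := tail_arg_rmul (F0_nc lt_b) (row_mx Z1 0) dX1 dP TX.
  have := eqF i (existT _ m2 (exist _ X2 dX2, B, w)).
  rewrite /= rmul_row_col rmulmx1 rmul0mx addr0 => ->.
  by rewrite lmul_col_mx lmul1mx lmul0mx.
rewrite coordP (negPf ne_a).
exact: (mxlin0 (ev_arg_linear (tail_nc_arg (F0_nc (ltn_ord a)) _ dP) i w dX2)).
Qed.

(** [G] stands for the prescribed derivative at a later point. Applied term by term, the operator
    sends [A] to G at Y and, by closedness, [diff0] to the coboundary of G between Y and X; the
    values at Y cancel and G at X remains. *)
Lemma tail_ddelta_prim j b (G : tail V n (x :: ins j R^o s)) :
    tail_nc G ->
    (forall a, (a < sdim x)%N ->
      forall m1 (X1 : 'M_m1) Z1 m2 (X2 : 'M_m2) B, sdom X1 -> sdom X2 ->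
        tail_eq (tail_ddelta 0 a G m1 X1 Z1 m2 X2 B)
                (tail_ddelta j b (F0 a X1 Z1 X2 B))) ->
    (forall W, tail_eq (tail_ddelta j b (A W)) (G p.+1 Y W)) ->
  tail_eq (tail_ddelta j.+1 b (prim Y A)) G.
Proof.
move=> G_nc F0_G A_G m X Z dX; have [x_nc s_nc] := xs_nc.
have dd_lin k := @tail_ddelta_linear R N n0 j b k s s_nc.
apply/tail_eqP=> i w; rewrite tail_ddeltaS (ev_op_sum (dd_lin m)).
have -> : ev i w (G m X Z) = \sum_b ev i w
    (G m X (rmulmx (rmulmx Z (delta_mx b ord0)) (delta_mx (ord0 : 'I_p.+1) b))).
  rewrite -(mxlin_sum (ev_arg_linear G_nc i w dX)); congr (ev _ _ (G _ _ _)).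
  rewrite -[LHS]rmulmx1 mx1_sum_delta.
  rewrite (big_morph (rmulmx Z) (rmulmxD Z) (rmulmx0 _ Z)).
  by apply: eq_bigr => c _; rewrite rmulmxA mul_delta_mx.
apply: eq_bigr => c _; set W := rmulmx Z _; set T := delta_mx _ c.
rewrite (ev_op_add (dd_lin m)) (ev_op_scale (dd_lin m)).
have /tail_eqP -> := tail_ddelta_act j b T (A W).
rewrite (ev_act_eq _ _ _ (A_G W)) (ev_op_sum (dd_lin m)).
have xG_nc : nc_slots (x :: ins j R^o s) by split=> //; apply: nc_slots_ins.
set D := rmulmx Y T - lmulmx T X.
have -> : \sum_(a < sdim x) ev i w (tail_ddelta j b (F0 a Y W X (coord_mx a D))) =
    \sum_(a < sdim x) ev i w (tail_ddelta 0 a G p.+1 Y W m X (coord_mx a D)).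
  apply: eq_bigr => a _.
  by have /tail_eqP -> := F0_G a (ltn_ord a) _ Y W _ X (coord_mx a D) dY dX.
rewrite (sum_tail_ddelta0 W T i w xG_nc G_nc dY dX).
by rewrite scaleN1r opprB addrC subrK.
Qed.

End FirstPrimitive.

(** * Antiderivatives by recursion on the points *)

Section Primitive.
Variables (R : comPzRingType) (N : lmodType R) (n0 : nat).
Local Notation V := (vals N n0).
Local Notation sd s j := (sdim (nth (slot0 R) s j)).

Definition tail_cast n (s s' : seq (slot R)) (e : s = s') (f : tail V n s) :
  tail V n s' := ecast t (tail V n t) e f.

Lemma tail_cast_id n s (e : s = s) (f : tail V n s) : tail_cast e f = f.
Proof. by rewrite (Prop_irrelevance e erefl). Qed.

Lemma tail_cast_cons n x s s' (e : x :: s = x :: s') (e' : s = s')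
    (f : tail V n (x :: s)) :
  tail_cast e f = fun m X Z => tail_cast e' (f m X Z).
Proof. by case: s' / e' e => e; rewrite tail_cast_id. Qed.

Definition tail_closed n s (F : forall j b : nat, tail V n (ins j R^o s)) : Prop :=
  forall i j a b (le_ij : (i <= j)%N), (j < size s)%N ->
    (a < sd s i)%N -> (b < sd s j)%N ->
  tail_eq (tail_cast (ins_ins R^o s le_ij) (tail_ddelta i a (F j b)))
          (tail_ddelta j.+1 b (F i a)).

(** For i = 0 the two slot lists are convertible and the cast is trivial; only the recursive clause,
    about the later points, still carries one. *)
Lemma tail_closed_cons n x s
    (F : forall j b : nat, tail V n (ins j R^o (x :: s))) :
  tail_closed F <->
  [/\ forall a b, (a < sdim x)%N -> (b < sdim x)%N ->
        tail_eq (tail_ddelta 0 a (F 0 b)) (tail_ddelta 1 b (F 0 a)),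
      forall j a b, (j < size s)%N -> (a < sdim x)%N -> (b < sd s j)%N ->
        tail_eq (tail_ddelta 0 a (F j.+1 b)) (tail_ddelta j.+2 b (F 0 a))
    & forall m (X : 'M_m) Z, sdom X ->
        tail_closed (fun j b => F j.+1 b m X Z)].
Proof.
split=> [F_closed|[F00 F0S FS]].
  split=> [a b lt_a lt_b|j a b lt_j lt_a lt_b|m X Z dX i j a b le_ij lt_j lt_a lt_b].
  - by move: (F_closed 0 0 a b (leqnn 0) isT lt_a lt_b); rewrite tail_cast_id.
  - by move: (F_closed 0 j.+1 a b (leq0n _) lt_j lt_a lt_b); rewrite tail_cast_id.
  have := F_closed i.+1 j.+1 a b le_ij lt_j lt_a lt_b.
  by rewrite (tail_cast_cons _ (ins_ins R^o s le_ij)); apply.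
case=> [|i] [|j] // a b le_ij lt_j lt_a lt_b.
- by rewrite tail_cast_id; apply: F00.
- by rewrite tail_cast_id; apply: F0S.
rewrite (tail_cast_cons _ (ins_ins R^o s (le_ij : (i <= j)%N))) => m X Z dX.
exact: FS.
Qed.

(* Arbitrary when the domain is empty. *)
Definition base_point (x : slot R) : {p : nat & 'M['rV[R]_(sdim x)]_p.+1} :=
  if pselect (exists P : {p : nat & 'M['rV[R]_(sdim x)]_p.+1}, sdom (projT2 P))
  is left exP then sval (cid exP) else existT _ 0%N (0 : 'M_1).

Lemma base_pointP (x : slot R) m (X : 'M['rV[R]_(sdim x)]_m) :
  is_ncset (@sdom R x) -> sdom X -> sdom (projT2 (base_point x)).
Proof.
move=> [dom_gt0 _] dX; rewrite /base_point; case: pselect => [exP|]; first by case: cid.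
case; case: m X dX (dom_gt0 _ _ dX) => // m X dX _.
by exists (existT _ m X).
Qed.

(** The constant of integration at each point is the antiderivative, in the later points, of the
    family evaluated at the base point; the last constant is chosen to be 0. *)
Fixpoint tail_antiderivative n s :
    (forall j b : nat, tail V n (ins j R^o s)) -> tail V n s :=
  match s return (forall j b : nat, tail V n (ins j R^o s)) -> tail V n s with
  | [::] => fun _ => (0 : 'M[N]_(n0, n))
  | x :: s' => fun F =>
      let Y := projT2 (base_point x) in
      prim (F 0) Y (fun W => tail_antiderivative (fun j b => F j.+1 b _ Y W))
  end.

(** Dependence on the family is linear, which makes the constant of integration [A W] linear in [W],
    as [prim] demands. *)
Lemma tail_antiderivative_linear n s a
    (F G H : forall j b : nat, tail V n (ins j R^o s)) :
    nc_slots s ->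
    (forall j b, (j < size s)%N -> (b < sd s j)%N -> tcomb a (F j b) (G j b) (H j b)) ->
  tcomb a (tail_antiderivative F) (tail_antiderivative G) (tail_antiderivative H).
Proof.
elim: s n F G H => [|x s IHs] n F G H.
  by move=> _ _ i w; rewrite /= !mxE scaler0 addr0.
case=> -[x_nc x_adm] s_nc FGH i [m [[[X dX] Z] w]].
have dY := base_pointP x_nc dX; rewrite /= !ev_sum scaler_sumr -big_split.
apply: eq_bigr => c _ /=; set Y := projT2 (base_point x) in dY *.
set W := rmulmx Z _; set T := delta_mx _ c; rewrite !ev_add !ev_scale.
rewrite (act_linear T a (tail_antiderivative (fun j b => F j.+1 b _ Y W))
                        (tail_antiderivative (fun j b => G j.+1 b _ Y W))).
  have -> D : ev i w (diff0 (H 0) Y W X D) =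
              a *: ev i w (diff0 (F 0) Y W X D) + ev i w (diff0 (G 0) Y W X D).
    rewrite !ev_sum scaler_sumr -big_split; apply: eq_bigr => b _ /=.
    exact: (FGH 0 b isT (ltn_ord b) i (existT _ _ (exist _ Y dY, W,
              existT _ m (exist _ X dX, coord_mx b D, w)))).
  by rewrite !scalerDr !scalerA [a * -1]mulrC addrACA.
apply: IHs => // j b lt_j lt_b i' v.
exact: (FGH j.+1 b lt_j lt_b i' (existT _ _ (exist _ Y dY, W, v))).
Qed.

Lemma tail_antiderivativeP n s (F : forall j b : nat, tail V n (ins j R^o s)) :
    nc_slots s ->
    (forall j b, (j < size s)%N -> (b < sd s j)%N -> tail_nc (F j b)) ->
    tail_closed F ->
  tail_nc (tail_antiderivative F) /\
  (forall j b, (j < size s)%N -> (b < sd s j)%N ->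
     tail_eq (tail_ddelta j b (tail_antiderivative F)) (F j b)).
Proof.
elim: s n F => [|x s IHs] n F; first by split.
move=> xs_nc F_nc /tail_closed_cons[F00 F0S FS]; have [[x_nc x_adm] s_nc] := xs_nc.
(* A base point outside the domain means that the domain is empty, and then every condition is
   vacuous. *)
have [dY|noY] := pselect (sdom (projT2 (base_point x))); last first.
  have noX m (X : 'M_m) : ~ @sdom R x m X by move=> dX; apply: noY (base_pointP x_nc dX).
  split; first by apply/tail_nc_cons; split=> [m X i w|m m' X X' T Z|m X Z] /noX.
  by case=> [|j] b _ _ m X Z /noX.
set Y := projT2 (base_point x) in dY.
pose A W := tail_antiderivative (fun j b => F j.+1 b _ Y W).
have F0_nc b : (b < sdim x)%N -> tail_nc (F 0 b) by apply: (F_nc 0%N b isT).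
have FS_nc j b m (X : 'M_m) Z : (j < size s)%N -> (b < sd s j)%N -> sdom X ->
  tail_nc (F j.+1 b m X Z).
  move=> lt_j lt_b dX.
  exact: (@tail_nc_arg R N n0 n x (ins j R^o s) _ (F_nc j.+1 b lt_j lt_b) m X Z dX).
have A_lin i w : mxlinear (fun W => ev i w (A W)).
  move=> a W W'; apply: tail_antiderivative_linear => // j b lt_j lt_b i' v.
  exact: (ev_arg_linear (F_nc j.+1 b lt_j lt_b)).
have [A_nc A_dd] : (forall W, tail_nc (A W)) /\ (forall W j b, (j < size s)%N ->
    (b < sd s j)%N -> tail_eq (tail_ddelta j b (A W)) (F j.+1 b _ Y W)).
  have AP W : _ := IHs _ (fun j b => F j.+1 b _ Y W) s_nc
    (fun j b lt_j lt_b => FS_nc j b _ Y W lt_j lt_b dY) (FS _ Y W dY).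
  by split=> W; have [] := AP W.
split; first exact: tail_nc_prim F0_nc xs_nc F00 _ _ _ dY A_lin A_nc.
case=> [|j] b lt_j lt_b.
  exact: tail_ddelta0_prim F0_nc xs_nc F00 _ _ _ dY A_lin A_nc b lt_b.
apply: (tail_ddelta_prim xs_nc dY) => // [|a lt_a m1 X1 Z1 m2 X2 B dX1 dX2|W].
- exact: (F_nc j.+1 b lt_j lt_b).
- by have := F0S j a b lt_j lt_a lt_b m1 X1 Z1 dX1 m2 X2 B dX2.
exact: A_dd.
Qed.

End Primitive.

(** * Closedness of differentials *)

Section Necessity.
Variables (R : comPzRingType) (N : lmodType R) (n0 : nat).
Local Notation V := (vals N n0).
Local Notation sd s j := (sdim (nth (slot0 R) s j)).

Lemma tail_ddelta_eq j a n s (f g : tail V n s) :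
  nc_slots s -> tail_eq f g -> tail_eq (tail_ddelta j a f) (tail_ddelta j a g).
Proof. by move=> s_nc; exact: (tail_op_eq (@tail_ddelta_linear R N n0 j a n s s_nc)). Qed.

(* Both sides evaluate f at a triangular point with diagonal X1, X2, X3; the
   two points, which differ by the scalars, are intertwined by a diagonal T. *)
Lemma tail_ddelta00 a b n x s (f : tail V n (x :: s)) :
    nc_slots (x :: s) -> tail_nc f ->
  tail_eq (tail_ddelta 0 a (tail_ddelta 0 b f))
          (tail_ddelta 1 b (tail_ddelta 0 a f)).
Proof.
case=> -[x_nc x_adm] s_nc f_nc m1 X1 Z1 dX1 m2 X2 A dX2 m3 X3 B dX3.
apply/tail_eqP=> i w.
pose e := basis_mx (R := R) (sdim x).
pose c p1 p2 : 'M[R]_(p1 + p2, p2) := col_mx 0 1%:M.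
pose r := adm_scalar (@sdom R x) X1 X2 (e a _ _ A).
pose P12 := block_mx X1 (scalemod r.1 (e a _ _ A)) 0 X2.
pose q := adm_scalar (@sdom R x) X2 X3 (e b _ _ B).
pose P23 := block_mx X2 (scalemod q.1 (e b _ _ B)) 0 X3.
transitivity (r.2 *: ev i w
    (tdelta f P12 (row_mx Z1 0) X3 (e b _ _ (lmulmx (c m1 m2) B)))).
  by rewrite -ev_scale.
transitivity (q.2 *: ev i w (act (c m2 m3)
    (tdelta f X1 Z1 P23 (e a _ _ (row_mx A 0))))); last by rewrite -ev_scale.
have -> : e b _ _ (lmulmx (c m1 m2) B) = col_mx 0 (e b _ _ B).
  rewrite lmul_col_mx lmul0mx lmul1mx /e /basis_mx map_col_mx; congr col_mx.
  by apply/matrixP=> k l; rewrite !mxE scale0r.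
have -> : e a _ _ (row_mx A (0 : 'M[R^o]_(m1, m3))) = row_mx (e a _ _ A) 0.
  rewrite /e /basis_mx map_row_mx; congr row_mx.
  by apply/matrixP=> k l; rewrite !mxE scale0r.
have [rK dP12] := adm_scalarP (e a _ _ A) x_adm dX1 dX2.
have [qK dP23] := adm_scalarP (e b _ _ B) x_adm dX2 dX3.
rewrite -/r -/q -/P12 -/P23 in rK qK dP12 dP23.
rewrite /tdelta (ev_op_scale (act_linear _)) ev_scale !scalerA.
have [] := adm_scalarP (col_mx 0 (e b _ _ B)) x_adm dP12 dX3.
set p := adm_scalar _ P12 _ _ => pK; set Q1 := block_mx _ _ _ _ => dQ1.
have [] := adm_scalarP (row_mx (e a _ _ A) 0) x_adm dX1 dP23.
set t := adm_scalar _ _ P23 _ => tK; set Q2 := block_mx _ _ _ _ => dQ2.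
(* Above the diagonal, Q1 carries the scalars r, p and Q2 carries t, q. Diagonal weights u, v, w
   must satisfy u r = t v and v p = q w; the solution used is t q, r q, p r. *)
pose T : 'M[R]_(m1 + (m2 + m3), m1 + m2 + m3) :=
  block_mx (row_mx (t.1 * q.1)%:M 0) 0
           (block_mx 0 (r.1 * q.1)%:M 0 0) (col_mx 0 (p.1 * r.1)%:M).
have TQ : lmulmx T Q1 = rmulmx Q2 T.
  have mx0 := (@lmulmx0 R, @lmul0mx R, @rmulmx0 R, @rmul0mx R, @scalemodr0 R,
    @addr0, @add0r).
  rewrite /T /Q1 /Q2 scalemod_row_mx scalemod_col_mx lmul_block rmul_block !mx0.
  rewrite /P12 /P23 lmul_row_block lmul_row_col rmul_mx_row rmul_row_block !mx0.
  rewrite rmul_row_col lmul_block lmul_block_col rmul_block rmul_block_col !mx0.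
  rewrite lmul_col_mx !mx0 !add_row_mx !add_col_mx !mx0.
  rewrite !lmulmx_scalar !rmulmx_scalar !scalemodA.
  congr block_mx; first by congr row_mx; rewrite mulrC [t.1 * _]mulrC mulrA.
  by congr col_mx; rewrite mulrC mulrA.
have /tail_eqP fT := tail_arg_rmul f_nc (row_mx Z1 0) dQ1 dQ2 TQ.
set L := ev i w (act _ _); set L' := ev i w (act _ _).
have key : (t.1 * q.1) *: L = (p.1 * r.1) *: L'.
  rewrite /L -(ev_op_scale (act_linear _)).
  rewrite -(ev_act_eq _ _ _ (tail_argZ f_nc _ _ dQ1)).
  have -> : scalemod (t.1 * q.1) (row_mx (row_mx Z1 0) 0) = rmulmx (row_mx Z1 0) T.
    rewrite /T rmul_row_block !rmulmx0 !rmul0mx !addr0 rmul_mx_row rmulmx0.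
    by rewrite rmulmx_scalar !scalemod_row_mx !scalemodr0.
  rewrite (ev_op_eq (act_linear _) _ _ fT) /L' !ev_act_act -ev_actZ; last first.
    exact: (tail_nc_arg f_nc _ dQ2).
  congr (ev _ _ (act _ _)).
  rewrite /T /c mul_block_col !mul_col_mx !mulmx0 !mul0mx !mul1mx !mulmx1 !add0r.
  by rewrite !scale_col_mx !scaler0 scalemx1 add_col_mx !add0r.
have inv2 (a1 a2 b1 b2 : R) : a1 * a2 = 1 -> b1 * b2 = 1 -> (b2 * a2) * (a1 * b1) = 1.
  by move=> aK bK; rewrite -mulrA [a2 * _]mulrA [a2 * _]mulrC aK mul1r mulrC.
have -> : r.2 * p.2 = q.2 * t.2 * (r.2 * p.2) * (t.1 * q.1).
  by rewrite [RHS]mulrAC (inv2 _ _ _ _ tK qK) mul1r.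
by rewrite -scalerA key scalerA -mulrA (inv2 _ _ _ _ pK rK) mulr1.
Qed.

(** Operators at distinct points commute: the one at the first point evaluates at P, acts and
    rescales, while the later one is linear and commutes with [act]. Two operators at the same point
    are handled by [tail_ddelta00]. *)
Lemma tail_closed_ddelta n s (f : tail V n s)
    (F : forall j b : nat, tail V n (ins j R^o s)) :
    nc_slots s -> tail_nc f ->
    (forall j b, (j < size s)%N -> (b < sd s j)%N ->
       tail_eq (tail_ddelta j b f) (F j b)) ->
  tail_closed F.
Proof.
elim: s n f F => [|x s IHs] n f F xs_nc f_nc fF; first by move=> i [].
have [[x_nc x_adm] s_nc] := xs_nc.
have xs_ins j : nc_slots (x :: ins j R^o s) by split=> //; apply: nc_slots_ins.
have xxs_nc : nc_slots (x :: Slot (@sdom R x) R^o :: s) by [].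
apply/tail_closed_cons; split=> [a b lt_a lt_b|j a b lt_j lt_a lt_b|m X Z dX].
- apply: tail_eq_trans (tail_ddelta_eq 0 a xxs_nc (tail_eq_sym (fF 0%N b isT lt_b))) _.
  apply: tail_eq_trans (tail_ddelta00 a b xs_nc f_nc) _.
  exact: (tail_ddelta_eq 1 b xxs_nc (fF 0%N a isT lt_a)).
- have fF_b := tail_eq_sym (fF j.+1 b lt_j lt_b).
  apply: tail_eq_trans (tail_ddelta_eq 0 a (xs_ins j) fF_b) _.
  apply: tail_eq_trans (tail_ddelta_eq j.+2 b xxs_nc (fF 0%N a isT lt_a)).
  move=> m1 X1 Z1 dX1 m2 X2 A dX2; set Z := basis_mx (sdim x) a A.
  have [_ dP] := adm_scalarP Z x_adm dX1 dX2.
  apply/tail_eqP=> i w.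
  have -> : ev i w (tail_ddelta j.+2 b (tail_ddelta 0 a f) m1 X1 Z1 m2 X2 A) =
            ev i w (tail_ddelta j b (tdelta f X1 Z1 X2 Z)) by [].
  rewrite /tdelta (ev_op_scale (@tail_ddelta_linear R N n0 j b m2 s s_nc)).
  have /tail_eqP -> := tail_ddelta_act j b (col_mx 0 1%:M)
    (f _ (block_mx X1 (scalemod (adm_scalar (@sdom R x) X1 X2 Z).1 Z) 0 X2)
       (row_mx Z1 0)).
  by rewrite -ev_scale.
apply: (IHs m (f m X Z)) => // [|j b lt_j lt_b]; first exact: tail_nc_arg.
exact: (fF j.+1 b lt_j lt_b m X Z dX).
Qed.

End Necessity.

(** * Functions with vanishing differentials *)

Section Constants.
Variables (R : comPzRingType) (N : lmodType R).
Local Notation sd s j := (sdim (nth (slot0 R) s j)).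

(** The coboundary identity with zero derivative. For S = I it says that the value does not depend
    on the point. *)
Fixpoint tail_invariant n0 n s : tail (vals N n0) n s -> Prop :=
  match s return tail (vals N n0) n s -> Prop with
  | [::] => fun _ => True
  | x :: s' => fun h =>
      (forall m1 (X1 : 'M_m1) m2 (X2 : 'M_m2) (S : 'M[R]_(m1, m2)) Z,
         sdom X1 -> sdom X2 -> tail_eq (h m2 X2 (rmulmx Z S)) (act S (h m1 X1 Z))) /\
      (forall m (X : 'M_m) Z, @sdom R x m X -> tail_invariant (h m X Z))
  end.

Lemma tail_invariant_ddelta n0 n s (h : tail (vals N n0) n s) :
    nc_slots s -> tail_nc h ->
    (forall j b i w, (j < size s)%N -> (b < sd s j)%N ->
       ev i w (tail_ddelta j b h) = 0) ->
  tail_invariant h.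
Proof.
elim: s n h => //= x s IHs n h xs_nc h_nc h0; split.
  move=> m1 X1 m2 X2 S Z dX1 dX2; apply/tail_eqP=> i w; apply/esym/eqP; rewrite -subr_eq0.
  rewrite -(sum_tail_ddelta0 Z S i w xs_nc h_nc dX1 dX2) big1 // => a _.
  exact: (h0 0%N a i (existT _ m1 (exist _ X1 dX1, Z,
            existT _ m2 (exist _ X2 dX2, coord_mx a _, w))) isT (ltn_ord a)).
move=> m X Z dX; apply: IHs; [by case: xs_nc | exact: tail_nc_arg |].
move=> j b i w lt_j lt_b.
exact: (h0 j.+1 b i (existT _ m (exist _ X dX, Z, w)) lt_j lt_b).
Qed.

Fixpoint kzero (s : seq (slot R)) : kmap N s :=
  match s with [::] => (0 : N) | _ :: s' => fun _ => kzero s' end.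

Lemma kmap_comb_idem s (f : kmap N s) : kmap_comb 1 f f f -> f = kzero s.
Proof.
elim: s f => [|x s IHs] /= f fz; last by apply/funext=> u; apply: IHs (fz u).
by apply: (addrI (f : N)); rewrite addr0 [RHS]fz scale1r.
Qed.

Lemma kmap_comb_zero s a : kmap_comb a (kzero s) (kzero s) (kzero s).
Proof. by elim: s => [|x s IHs] //=; rewrite scaler0 addr0. Qed.

Lemma klinear0 x s (c : kmap N (x :: s)) : klinear c -> c 0 = kzero s.
Proof.
by case=> c_lin _; apply: kmap_comb_idem; have := c_lin 1 0 0; rewrite scaler0 addr0.
Qed.

Lemma klinear_kzero s : klinear (kzero s).
Proof. by elim: s => //= x s IHs; split=> // a u v; apply: kmap_comb_zero. Qed.

Definition entry_mx (M : lmodType R) m n (a : 'I_m) (b : 'I_n) (u : M) : 'M[M]_(m, n) :=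
  \matrix_(k, l) if (k == a) && (l == b) then u else 0.

Lemma entry_mx_linear (M : lmodType R) m n (a : 'I_m) (b : 'I_n) c (u v : M) :
  entry_mx a b (c *: u + v) = scalemod c (entry_mx a b u) + entry_mx a b v.
Proof. by apply/matrixP=> k l; rewrite !mxE; case: ifP; rewrite ?scaler0 ?addr0. Qed.

(** Factoring an entry through column [ord0] prepares it for a base point: invariance applies with S
    = E_(0,b). *)
Lemma entry_mx_rmul (M : lmodType R) m n p (a : 'I_m) (b : 'I_n) (u : M) :
  rmulmx (entry_mx a (ord0 : 'I_p.+1) u) (delta_mx ord0 b) = entry_mx a b u.
Proof.
apply/matrixP=> i j; rewrite !mxE (bigD1 ord0) //= big1 => [|l ne_l].
  rewrite !mxE !eqxx andbT addr0 /=.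
  by do 2!case: eqP => _; rewrite ?scale1r ?scaler0 ?scale0r.
by rewrite !mxE (negPf ne_l) andbF scaler0.
Qed.

Lemma sum_entry_mx (M : lmodType R) m n (Z : 'M[M]_(m, n)) :
  Z = \sum_a \sum_b entry_mx a b (Z a b).
Proof.
apply/matrixP=> i j; rewrite summxE (bigD1 i) //= summxE (bigD1 j) //=.
rewrite mxE !eqxx !big1 ?addr0 // => [a ne_a|b ne_b].
  by rewrite summxE big1 // => b _; rewrite mxE eq_sym (negPf ne_a).
by rewrite mxE eqxx eq_sym (negPf ne_b).
Qed.

(* The slots with empty domain give the zero map. *)
Fixpoint tail_const n0 n s : tail (vals N n0) n s -> 'I_n -> 'I_n0 -> kmap N s :=
  match s return tail (vals N n0) n s -> 'I_n -> 'I_n0 -> kmap N s with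
  | [::] => fun h a i => (h : 'M[N]_(n0, n)) i a
  | x :: s' => fun h a i u =>
      if pselect (sdom (projT2 (base_point x))) is left _
      then tail_const (h _ (projT2 (base_point x)) (entry_mx a ord0 u)) ord0 i
      else kzero s'
  end.

Lemma tail_const_comb n0 n s a (f g h : tail (vals N n0) n s) k i :
  tcomb a f g h ->
  kmap_comb a (tail_const f k i) (tail_const g k i) (tail_const h k i).
Proof.
elim: s n f g h k => [|x s IHs] n f g h k fgh; first exact: (fgh i k).
move=> u /=; case: pselect => [dY|_]; last exact: kmap_comb_zero.
by apply: IHs => j w; apply: (fgh j (existT _ _ (exist _ _ dY, _, w))).
Qed.

Lemma klinear_tail_const n0 n s (h : tail (vals N n0) n s) k i :
  tail_nc h -> klinear (tail_const h k i).
Proof.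
elim: s n h k => // x s IHs n h k h_nc; split=> [a u v|u] /=; case: pselect => [dY|_].
- apply: tail_const_comb => j w; rewrite entry_mx_linear.
  exact: (ev_arg_linear h_nc).
- exact: kmap_comb_zero.
- by apply: IHs; apply: tail_nc_arg.
exact: klinear_kzero.
Qed.

Lemma path_sum_rows n0 n n' x s (r : 'I_n0 -> 'I_n) (r' : 'I_n0 -> 'I_n')
    (c : 'I_n0 -> smod x -> kmap N s) m (X : 'M_m)
    (Z : 'M[smod x]_(n, m)) (Z' : 'M[smod x]_(n', m)) :
    (forall i b, Z (r i) b = Z' (r' i) b) ->
  path_sum r c X Z = path_sum r' c X Z'.
Proof.
case: s c => [|y s] c eqZ /=; first by apply/matrixP=> i b; rewrite !mxE eqZ.
apply: (congr1 (@tail_sum R N n0 m m (y :: s))); apply/funext=> b.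
by congr (path_sum _ _); apply/funext=> i; rewrite eqZ.
Qed.

Lemma path_sum0 n0 n x s (r : 'I_n0 -> 'I_n) (c : 'I_n0 -> smod x -> kmap N s)
    m (X : 'M_m) (Z : 'M[smod x]_(n, m)) i w :
    (forall k b, c k (Z (r k) b) = kzero s) ->
  ev i w (path_sum r c X Z) = 0.
Proof.
elim: s x n r c m X Z w => [|y s IHs] x n r c m X Z w c0; first by rewrite /= mxE c0.
case: w => p [[X' Z'] w]; rewrite /= ev_sum big1 // => b _.
by apply: IHs => k b'; rewrite c0.
Qed.

Lemma ev_path_sum_row n0 n x s (r : 'I_n0 -> 'I_n) (c : 'I_n0 -> smod x -> kmap N s)
    m (X : 'M_m) Z i w :
  ev i w (path_sum r c X Z) =
  ev (ord0 : 'I_1) w (path_sum (fun=> r i) (fun=> c i) X Z).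
Proof.
elim: s x n r c m X Z w => [|y s IHs] x n r c m X Z w; first by rewrite /= !mxE.
case: w => p [[X' Z'] w]; rewrite /= !ev_sum; apply: eq_bigr => b _.
by rewrite IHs.
Qed.

(** Z is split into its entries u at (a, b), each factored as u at (a, 0) times E_(0,b). Invariance
    replaces X by the base point and passes E_(0,b) to the next argument, so a path that arrives at
    b continues from row b. *)
Lemma tail_invariant_path_sum n0 n x s (h : tail (vals N n0) n (x :: s)) :
    nc_slots (x :: s) -> tail_nc h -> tail_invariant h ->
  tail_eq h (tail_sum (fun a : 'I_n => path_sum (fun=> a) (fun i => tail_const h a i))).
Proof.
elim: s x n h => [|y s IHs] x n h xs_nc h_nc [h_inv h_invX];
  apply/tail_eqP=> i [m [[[X dX] Z] w]]; have [[x_nc x_adm] s_nc] := xs_nc;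
  have dY := base_pointP x_nc dX; rewrite ev_sum.
  have h_lin := ev_arg_linear h_nc i (w : args m [::]) dX.
  transitivity (@ev R N n0 i m [::] w (h m X Z)) => //.
  rewrite {1}(sum_entry_mx Z) (mxlin_sum h_lin).
  apply: eq_bigr => a _; rewrite (mxlin_sum h_lin).
  rewrite (bigD1 w) //= big1 => [|b ne_b].
    rewrite !mxE -(@entry_mx_rmul _ _ _ (projT1 (base_point x))).
    have /matrixP -> := h_inv _ _ _ X (delta_mx ord0 w) (entry_mx a ord0 (Z a w)) dY dX.
    rewrite addr0 mxE (bigD1 ord0) //= mxE !eqxx scale1r big1 ?addr0.
      by case: pselect.
    by move=> l ne_l; rewrite mxE (negPf ne_l) scale0r.
  rewrite -(@entry_mx_rmul _ _ _ (projT1 (base_point x))).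
  have /matrixP -> := h_inv _ _ _ X (delta_mx ord0 b) (entry_mx a ord0 (Z a b)) dY dX.
  by rewrite mxE big1 // => l _; rewrite mxE [w == b]eq_sym (negPf ne_b) andbF scale0r.
transitivity (@ev R N n0 i m (y :: s) w (h m X Z)) => //.
rewrite {1}(sum_entry_mx Z) (mxlin_sum (ev_arg_linear h_nc i w dX)).
apply: eq_bigr => a _; rewrite (mxlin_sum (ev_arg_linear h_nc i w dX)).
rewrite [RHS]/= ev_sum; apply: eq_bigr => b _.
rewrite -(@entry_mx_rmul _ _ _ (projT1 (base_point x))).
have /tail_eqP -> := h_inv _ _ _ X (delta_mx ord0 b) (entry_mx a ord0 (Z a b)) dY dX.
pose g : tail (vals N n0) _ (y :: s) :=
  h _ (projT2 (base_point x)) (entry_mx a ord0 (Z a b)).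
have g_nc : tail_nc g by apply: tail_nc_arg.
have -> : (fun i => if pselect (sdom (projT2 (base_point x))) is left _
    then fun u => if pselect (sdom (projT2 (base_point y))) is left _
      then tail_const (g _ (projT2 (base_point y)) (entry_mx ord0 ord0 u)) ord0 i
      else kzero s
    else fun=> kzero s) = tail_const g ord0.
  by apply/funext=> k; case: pselect.
rewrite (ev_act_eq _ _ _ (IHs y _ g s_nc g_nc (h_invX _ _ _ dY))).
(* The next argument Z' has become E_(0,b) Z', whose row 0 is row b of Z' and whose other rows
   vanish. *)
rewrite (ev_op_sum (act_linear _)) (bigD1 ord0) //= big1 => [|c ne_c].
  rewrite addr0; congr (ev _ _ _); apply: path_sum_rows => k l.
  rewrite mxE (bigD1 b) //= mxE !eqxx scale1r big1 ?addr0 // => l' ne_l'.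
  by rewrite mxE (negPf ne_l') andbF scale0r.
apply: path_sum0 => k l.
have -> : lmulmx (delta_mx ord0 b) (projT2 w).1.2 c l = 0.
  by rewrite mxE big1 // => l' _; rewrite mxE (negPf ne_c) scale0r.
exact: (klinear0 (klinear_tail_const c k g_nc)).
Qed.

End Constants.

(** * The first point *)

Section LeftMultiplication.
Variables (R : comPzRingType) (N : lmodType R).

Lemma ev_lmul n0 n1 (T : 'M[R]_(n1, n0)) n s (f : tail (vals N n0) n s) i w :
  ev i w (tail_lmul T f) = \sum_l T i l *: ev l w f.
Proof. by elim: s n f w => [|x s IHs] n f w /=; rewrite ?mxE ?IHs. Qed.

Lemma ev_lmul_delta n0 n1 k l n s (f : tail (vals N n0) n s) w :
  ev k w (tail_lmul (delta_mx k l : 'M[R]_(n1, n0)) f) = ev l w f.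
Proof.
rewrite ev_lmul (bigD1 l) //= mxE !eqxx scale1r big1 ?addr0 // => j ne_j.
by rewrite mxE (negPf ne_j) andbF scale0r.
Qed.

Lemma tail_lmul_linear n0 n1 (T : 'M[R]_(n1, n0)) n (s : seq (slot R)) :
  tail_op_linear (@tail_lmul R N n0 n1 T n s).
Proof.
move=> a f g h fgh i w; rewrite !ev_lmul scaler_sumr -big_split.
by apply: eq_bigr => l _ /=; rewrite fgh scalerDr !scalerA mulrC.
Qed.

Lemma tail_lmul_act n0 n1 (T : 'M[R]_(n1, n0)) n m (S : 'M[R]_(n, m)) s
    (f : tail (vals N n0) n s) :
  tail_eq (act S (tail_lmul T f)) (tail_lmul T (act S f)).
Proof.
case: s f => [|x s] f; last by move=> p X Z dX; apply: tail_eq_refl.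
exact: esym (lrmulmxA T (f : 'M[N]_(n0, n)) S).
Qed.

Lemma tail_nc_lmul n0 n1 (T : 'M[R]_(n1, n0)) n s (f : tail (vals N n0) n s) :
  tail_nc f -> tail_nc (tail_lmul T f).
Proof.
elim: s n f => // x s IHs n f f_nc; apply/tail_nc_cons.
have [f_lin f_int f_ncX] := (tail_nc_cons f).1 f_nc.
split=> [m X i w dX a Z W|m m' X X' S Z dX dX' SX|m X Z dX]; last first.
- exact/IHs/f_ncX.
- apply: tail_eq_trans (tail_eq_sym (tail_lmul_act _ _ _)).
  exact: (tail_op_eq (@tail_lmul_linear _ _ T _ s)) (f_int _ _ _ _ _ _ dX dX' SX).
rewrite /= !ev_lmul scaler_sumr -big_split; apply: eq_bigr => l _ /=.
by rewrite f_lin // scalerDr !scalerA mulrC.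
Qed.

Lemma tail_ddelta_lmul n0 n1 (T : 'M[R]_(n1, n0)) j b n s
    (f : tail (vals N n0) n s) :
  tail_eq (tail_ddelta j b (tail_lmul T f)) (tail_lmul T (tail_ddelta j b f)).
Proof.
elim: s j n f => [|x s IHs] [|j] n f //.
  move=> m1 X1 Z1 dX1 m2 X2 A dX2; apply/tail_eqP=> i w.
  rewrite [LHS]ev_scale.
  pose D := basis_mx (sdim x) b A.
  have /tail_eqP -> := tail_lmul_act T (col_mx 0 1%:M)
    (f _ (block_mx X1 (scalemod (adm_scalar (@sdom R x) X1 X2 D).1 D) 0 X2)
       (row_mx Z1 0)).
  by rewrite -(ev_op_scale (@tail_lmul_linear _ _ T _ s)).
by move=> m X Z dX; apply: IHs.
Qed.

End LeftMultiplication.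

Section Reduction.
Variable R : comPzRingType.
Variables (x : slot R).
Local Notation N := (smod x).
Local Notation x1 := (Slot (@sdom R x) R^o).

(* An nc function f is the same as the tail (X^0, Z^0) |-> Z^0 f(X^0), where
   Z^0 ranges over the rows over R: then condition (i) becomes (ii). *)
Definition tail_of s (f : ncfun (x :: s)) : tail (vals N 1) 1 (x1 :: s) :=
  fun m X Z => tail_lmul (Z : 'M[R]_(1, m)) (f m X).

Definition nc_of s (g : tail (vals N 1) 1 (x1 :: s)) : ncfun (x :: s) :=
  fun m X => tail_sum (fun l : 'I_m =>
    tail_lmul (delta_mx l ord0 : 'M[R]_(m, 1)) (g m X (delta_mx ord0 l))).

Lemma ev_tail_of s (f : ncfun (x :: s)) m (X : 'M_m) l w :
  ev ord0 w (tail_of f X (delta_mx ord0 l)) = ev l w (f m X).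
Proof. exact: ev_lmul_delta. Qed.

Lemma tail_of_eq s (f g : ncfun (x :: s)) :
  nc_eq f g <-> tail_eq (tail_of f) (tail_of g).
Proof.
split=> fg m X.
  by move=> Z dX; exact: (tail_op_eq (@tail_lmul_linear R N m 1 Z m s) (fg m X dX)).
move=> dX; apply/tail_eqP=> l w.
have /tail_eqP/(_ ord0 w) := fg m X (delta_mx ord0 l) dX.
by rewrite !ev_tail_of.
Qed.

(** In the converse direction the basis rows suffice: they recover each row of f(X), and condition
    (ii) tested on them is condition (i) row by row. *)
Lemma tail_of_nc s (f : ncfun (x :: s)) : is_ncfun f <-> tail_nc (tail_of f).
Proof.
split=> [[f_lin f_int0 f_int]|/tail_nc_cons[f_lin f_int f_nc]].
  apply/tail_nc_cons; split=> [m X i w dX a Z W|m m' X X' T Z dX dX' TX|m X Z dX].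
  - rewrite !ev_lmul scaler_sumr -big_split; apply: eq_bigr => l _ /=.
    by rewrite !mxE scalerDl scalerA.
  - apply/tail_eqP=> i w; rewrite /tail_of.
    have /tail_eqP -> := tail_lmul_act (Z : 'M[R]_(1, m')) T (f m' X').
    have fTX := f_int0 _ _ X X' T dX dX' TX.
    have /tail_eqP <- := tail_op_eq (@tail_lmul_linear R N m' 1 Z m s) fTX.
    rewrite !ev_lmul; under [RHS]eq_bigr do rewrite ev_lmul scaler_sumr.
    rewrite exchange_big; apply: eq_bigr => l _ /=; rewrite mxE scaler_suml.
    by apply: eq_bigr => k _; rewrite scalerA mulrC.
  by apply: tail_nc_lmul; split; [apply: f_lin | apply: f_int].
have fX_nc m (X : 'M_m) : @sdom R x m X -> tail_nc (f m X).
  move=> dX; suff fX : tail_eq (f m X) (tail_sum (fun l : 'I_m =>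
      tail_lmul (delta_mx l ord0 : 'M[R]_(m, 1)) (tail_of f X (delta_mx ord0 l)))).
    apply: tail_nc_eq (tail_eq_sym fX) _; apply: tail_nc_sum => l.
    exact/tail_nc_lmul/f_nc.
  apply/tail_eqP=> i w; rewrite ev_sum (bigD1 i) //=.
  rewrite ev_lmul_delta ev_tail_of big1 ?addr0 // => k ne_k.
  by rewrite ev_lmul big_ord1 mxE eq_sym (negPf ne_k) scale0r.
split=> [m X /fX_nc[]//|m m' X X' T dX dX' TX|m X /fX_nc[]//].
apply/tail_eqP=> i w.
have /tail_eqP/(_ ord0 w) := f_int _ _ _ _ T (delta_mx ord0 i) dX dX' TX.
have /tail_eqP -> := tail_lmul_act (delta_mx ord0 i : 'M[R]_(1, m')) T (f m' X').
rewrite ev_lmul_delta => <-; rewrite !ev_lmul; apply: eq_bigr => l _; congr (_ *: _).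
rewrite mxE (bigD1 i) //= mxE !eqxx big1 => [|k ne_k].
  by rewrite addr0; exact: esym (mulr1 _).
by rewrite mxE (negPf ne_k) scaler0.
Qed.

Lemma nc_ofK s (g : tail (vals N 1) 1 (x1 :: s)) :
  tail_nc g -> tail_eq (tail_of (nc_of g)) g.
Proof.
move=> g_nc m X Z dX; apply/tail_eqP=> i w; rewrite ord1 ev_lmul.
rewrite [in RHS](sum_entry_mx Z) big_ord1 (mxlin_sum (ev_arg_linear g_nc ord0 w dX)).
apply: eq_bigr => l _.
have -> : entry_mx ord0 l (Z ord0 l) =
    scalemod (Z ord0 l) (delta_mx ord0 l : 'M[R^o]_(1, m)).
  apply/matrixP=> k k'; rewrite !mxE; case: ifP => _; first exact: esym (mulr1 _).
  by rewrite scaler0.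
rewrite (mxlinZ (ev_arg_linear g_nc ord0 w dX)); congr (_ *: _).
rewrite ev_sum (bigD1 l) //= ev_lmul_delta big1 ?addr0 // => k ne_k.
by rewrite ev_lmul big_ord1 mxE eq_sym (negPf ne_k) scale0r.
Qed.

Definition tail_of_ins j L s :
    ncfun (ins j L (x :: s)) -> tail (vals N 1) 1 (ins j L (x1 :: s)) :=
  match j return ncfun (ins j L (x :: s)) -> tail (vals N 1) 1 (ins j L (x1 :: s)) with
  | 0%N => fun f => @tail_of (Slot (@sdom R x) L :: s) f
  | j'.+1 => fun f => @tail_of (ins j' L s) f
  end.

Lemma tail_of_ins_eq j L s (f g : ncfun (ins j L (x :: s))) :
  nc_eq f g <-> tail_eq (tail_of_ins f) (tail_of_ins g).
Proof. by case: j f g => [|j] f g; apply: tail_of_eq. Qed.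

Lemma tail_of_ins_nc j L s (f : ncfun (ins j L (x :: s))) :
  is_ncfun f <-> tail_nc (tail_of_ins f).
Proof. by case: j f => [|j] f; apply: tail_of_nc. Qed.

(** For j = 0 the factor [I 0] in the operator meets the auxiliary row: Z1 [I 0] = [Z1 0], which is
    the argument used at every other point. *)
Lemma tail_of_ddelta j b s (f : ncfun (x :: s)) :
  tail_eq (tail_of_ins (ddelta j b f)) (tail_ddelta j b (tail_of f)).
Proof.
case: j => [|j]; last first.
  by move=> m X Z dX; apply: tail_eq_sym; apply: tail_ddelta_lmul.
move=> m1 X1 Z1 dX1 m2 X2 A dX2; apply/tail_eqP=> i w.
pose r := adm_scalar (@sdom R x) X1 X2 (basis_mx (sdim x) b A).
pose fP := f _ (block_mx X1 (scalemod r.1 (basis_mx (sdim x) b A)) 0 X2).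
transitivity (ev i w (tail_lmul (Z1 : 'M[R]_(1, m1)) (tail_scale r.2
    (tail_lmul (row_mx 1%:M 0) (act (col_mx 0 1%:M) fP))))) => //.
transitivity (ev i w (tail_scale r.2 (act (col_mx 0 1%:M)
    (tail_lmul (row_mx (Z1 : 'M[R]_(1, m1)) 0) fP)))) => //.
rewrite (ev_op_scale (@tail_lmul_linear R N m1 1 Z1 m2 s)) ev_scale; congr (_ *: _).
have /tail_eqP -> := tail_lmul_act (row_mx (Z1 : 'M[R]_(1, m1)) 0) (col_mx 0 1%:M) fP.
rewrite !ev_lmul big_split_ord /= [X in _ = _ + X]big1 ?addr0 => [|k _]; last first.
  by rewrite row_mxEr mxE scale0r.
apply: eq_bigr => l _; rewrite row_mxEl ev_lmul big_split_ord /=.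
rewrite [X in _ *: (_ + X)]big1 ?addr0 => [|k _]; last by rewrite row_mxEr mxE scale0r.
rewrite (bigD1 l) //= row_mxEl mxE eqxx scale1r big1 ?addr0 // => k ne_k.
by rewrite row_mxEl mxE eq_sym (negPf ne_k) scale0r.
Qed.

Lemma tail_of_cast s s' (e : x :: s = x :: s') (e' : x1 :: s = x1 :: s')
    (f : ncfun (x :: s)) :
  tail_of (nc_cast e f) = tail_cast e' (tail_of f).
Proof.
have eq_s : s = s' by case: e.
case: s' / eq_s e e' => e e'; rewrite tail_cast_id.
by rewrite (Prop_irrelevance e erefl).
Qed.

Lemma tail_cast_eq (N' : lmodType R) n0 n s s' (e : s = s')
    (f g : tail (vals N' n0) n s) :
  tail_eq f g -> tail_eq (tail_cast e f) (tail_cast e g).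
Proof. by case: s' / e. Qed.

Lemma tail_of_cast_eq s s' (e : x :: s = x :: s') (e' : x1 :: s = x1 :: s')
    (f : ncfun (x :: s)) (g : ncfun (x :: s')) f' g' :
    tail_eq (tail_of f) f' -> tail_eq (tail_of g) g' ->
  nc_eq (nc_cast e f) g <-> tail_eq (tail_cast e' f') g'.
Proof.
move=> ff' gg'; apply: (iff_trans (tail_of_eq _ _)).
rewrite (tail_of_cast e e'); have ff'e := tail_cast_eq e' ff'; split=> fg.
  exact: tail_eq_trans (tail_eq_sym ff'e) (tail_eq_trans fg gg').
exact: tail_eq_trans ff'e (tail_eq_trans fg (tail_eq_sym gg')).
Qed.

Lemma tail_of_closed s (F : forall j b : nat, ncfun (ins j R^o (x :: s))) :
  (forall i j a b (le_ij : (i <= j)%N), (j < size (x :: s))%N ->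
     (a < sdim (nth (slot0 R) (x :: s) i))%N ->
     (b < sdim (nth (slot0 R) (x :: s) j))%N ->
     nc_eq (nc_cast (ins_ins R^o (x :: s) le_ij) (ddelta i a (F j b)))
           (ddelta j.+1 b (F i a))) <->
  tail_closed (fun j b => tail_of_ins (F j b)).
Proof.
suff closed_ij i j a b (le_ij : (i <= j)%N) :
    nc_eq (nc_cast (ins_ins R^o (x :: s) le_ij) (ddelta i a (F j b)))
          (ddelta j.+1 b (F i a)) <->
    tail_eq (tail_cast (ins_ins R^o (x1 :: s) le_ij)
               (tail_ddelta i a (tail_of_ins (F j b))))
            (tail_ddelta j.+1 b (tail_of_ins (F i a))).
  have sdim1 k : sdim (nth (slot0 R) (x1 :: s) k) = sdim (nth (slot0 R) (x :: s) k).
    by case: k.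
  split=> F_closed i j a b le_ij lt_j lt_a lt_b; apply/closed_ij.
    by apply: F_closed; rewrite -?sdim1.
  by apply: F_closed; rewrite ?sdim1.
case: i j le_ij => [|i] [|j] // le_ij.
- exact: (tail_of_cast_eq _ _ (@tail_of_ddelta 0 a (Slot (@sdom R x) R^o :: s) (F 0%N b))
    (@tail_of_ddelta 1 b (Slot (@sdom R x) R^o :: s) (F 0%N a))).
- exact: (tail_of_cast_eq _ _ (@tail_of_ddelta 0 a (ins j R^o s) (F j.+1 b))
    (@tail_of_ddelta j.+2 b (Slot (@sdom R x) R^o :: s) (F 0%N a))).
exact: (tail_of_cast_eq _ _ (@tail_of_ddelta i.+1 a (ins j R^o s) (F j.+1 b))
    (@tail_of_ddelta j.+2 b (ins i R^o s) (F i.+1 a))).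
Qed.

End Reduction.

(** * Integrability and uniqueness for nc functions *)

Section NCIntegration.
Variables (R : comPzRingType) (x : slot R) (s : seq (slot R)).
Local Notation N := (smod x).
Local Notation x1 := (Slot (@sdom R x) R^o).
Local Notation sd s j := (sdim (nth (slot0 R) s j)).
Variable F : forall j b : nat, ncfun (ins j R^o (x :: s)).
Hypothesis xs_nc : nc_slots (x :: s).

Definition nc_antiderivative (f : ncfun (x :: s)) : Prop :=
  is_ncfun f /\
  (forall j b, (j < size (x :: s))%N -> (b < sd (x :: s) j)%N ->
     nc_eq (ddelta j b f) (F j b)).

Lemma tail_of_antiderivative f :
  nc_antiderivative f <->
  tail_nc (tail_of f) /\
  (forall j b, (j < size (x1 :: s))%N -> (b < sd (x1 :: s) j)%N ->
     tail_eq (tail_ddelta j b (tail_of f)) (tail_of_ins (F j b))).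
Proof.
have sdim1 j : sd (x1 :: s) j = sd (x :: s) j by case: j.
split=> -[f_nc fF]; split; try exact/tail_of_nc; move=> j b lt_j lt_b.
  have /tail_of_ins_eq := fF j b lt_j (eq_ind _ (leq b.+1) lt_b _ (sdim1 j)).
  exact: tail_eq_trans (tail_eq_sym (tail_of_ddelta _ _ _)).
apply/tail_of_ins_eq; apply: tail_eq_trans (tail_of_ddelta _ _ _) _.
by apply: fF; rewrite ?sdim1.
Qed.

Lemma nc_antiderivativeP :
    (forall j b, (j < size (x :: s))%N -> (b < sd (x :: s) j)%N ->
       is_ncfun (F j b)) ->
  (exists f, nc_antiderivative f) <->
  (forall i j a b (le_ij : (i <= j)%N), (j < size (x :: s))%N ->
     (a < sd (x :: s) i)%N -> (b < sd (x :: s) j)%N ->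
     nc_eq (nc_cast (ins_ins R^o (x :: s) le_ij) (ddelta i a (F j b)))
           (ddelta j.+1 b (F i a))).
Proof.
move=> F_nc; apply: iff_trans (iff_sym (tail_of_closed F)).
split=> [[f /tail_of_antiderivative[f_nc fF]]|F_closed].
  exact: tail_closed_ddelta fF.
have [] := @tail_antiderivativeP R N 1 1 (x1 :: s) _ xs_nc _ F_closed.
  by case=> [|j] b lt_j lt_b; apply/tail_of_ins_nc/F_nc.
set g := tail_antiderivative _ => g_nc gF; exists (nc_of g); apply/tail_of_antiderivative.
have gK := nc_ofK g_nc; split; first exact: tail_nc_eq (tail_eq_sym gK) g_nc.
move=> j b lt_j lt_b; apply: tail_eq_trans (gF j b lt_j lt_b).
exact: (@tail_ddelta_eq R N 1 j b 1 (x1 :: s)).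
Qed.

End NCIntegration.

Lemma nc_antiderivative_unique (R : comPzRingType) (x y : slot R) s
    (F : forall j b : nat, ncfun (ins j R^o [:: x, y & s])) f f' :
    nc_slots [:: x, y & s] -> nc_antiderivative F f -> nc_antiderivative F f' ->
  exists c : kmap_of [:: x, y & s],
    is_klinear c /\ nc_eq f' (nc_add f (nc_const c)).
Proof.
move=> s_nc /tail_of_antiderivative[f_nc fF] /tail_of_antiderivative[f'_nc f'F].
set x1 := Slot (@sdom R x) R^o in fF f'F.
pose h : tail (vals (smod x) 1) 1 [:: x1, y & s] :=
  tail_add (tail_of f') (tail_scale (-1) (tail_of f)).
have h_nc : tail_nc h by apply/tail_nc_add/tail_nc_scale.
have h_inv : tail_invariant h.
  apply: tail_invariant_ddelta => // j b i w lt_j lt_b.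
  have dd_lin := @tail_ddelta_linear R (smod x) 1 j b 1 [:: x1, y & s] s_nc.
  rewrite (ev_op_add dd_lin) (ev_op_scale dd_lin).
  have /tail_eqP -> := fF j b lt_j lt_b; have /tail_eqP -> := f'F j b lt_j lt_b.
  by rewrite scaleN1r subrr.
have [c_lin c_linX] : klinear (tail_const h ord0 ord0) by apply: klinear_tail_const.
(* The first variable of the multilinear map is the auxiliary scalar; setting it to 1 leaves a map
   of Z^1, ..., Z^k. *)
exists (tail_const h ord0 ord0 (1 : R^o)); split; first exact: c_linX.
move=> m X dX; apply/tail_eqP=> l w.
have /tail_eqP h_path :=
  @tail_invariant_path_sum R (smod x) 1 1 x1 (y :: s) h s_nc h_nc h_inv.
pose c := tail_const h ord0.
pose v : args 1 [:: x1, y & s] := existT _ m (exist _ X dX, delta_mx ord0 l, w).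
have f'f : ev l w (f' m X) - ev l w (f m X) =
    \sum_b ev ord0 w (path_sum (fun=> b)
      (fun k => c k ((delta_mx ord0 l : 'M[R^o]_(1, m)) ord0 b))).
  transitivity (ev ord0 v h).
    by rewrite /h ev_add ev_scale scaleN1r -!ev_tail_of.
  by rewrite h_path ev_sum big_ord1; apply: (@ev_sum _ _ _ m (y :: s)).
rewrite -[LHS](subrK (ev l w (f m X))) f'f addrC.
rewrite [RHS](ev_add l w (f m X)); congr (_ + _).
(* The auxiliary row is the basis row at [l], so only the paths that start at [l] survive, with
   scalar 1. *)
rewrite [RHS]ev_path_sum_row (bigD1 l) //= big1 => [|b ne_b].
  rewrite addr0; congr (ev _ _ (path_sum _ _)); apply/funext=> k.
  by rewrite mxE !eqxx [k]ord1.
apply: path_sum0 => k b'; rewrite mxE (negPf ne_b) ord1.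
by rewrite /c klinear0.
Qed.

Lemma nc_slots_slots (R : comPzRingType) k (d : nat -> nat)
    (Om : forall j, ncsub 'rV[R]_(d j)) (N : nat -> lmodType R) :
    (forall j, (j <= k)%N -> is_ncset (Om j) /\ right_admissible (Om j)) ->
  nc_slots (slots k Om N).
Proof.
move=> Om_nc; suff ok n m :
    (forall j, (j < m + n)%N -> is_ncset (Om j) /\ right_admissible (Om j)) ->
    nc_slots [seq Slot (Om j) (N j) | j <- iota m n] by apply: (ok k.+1 0%N).
elim: n m => // n IHn m Om_m /=; split.
  by apply: Om_m; rewrite addnS ltnS leq_addr.
by apply: IHn => j; rewrite addSnnS; apply: Om_m.
Qed.

Theorem theorem3p1 (R : comPzRingType) (k : nat) (d : nat -> nat)
    (Om : forall j : nat, ncsub 'rV[R]_(d j)) (N : nat -> lmodType R)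
    (F : forall j beta : nat, ncfun (ins j R^o (slots k Om N))) :
  (1 <= k)%N ->
  (forall j, (j <= k)%N -> (1 <= d j)%N) ->
  (forall j, (j <= k)%N -> is_ncset (Om j) /\ right_admissible (Om j)) ->
  (forall j beta, (j <= k)%N -> (beta < d j)%N -> is_ncfun (F j beta)) ->
  let antiderivative (f : ncfun (slots k Om N)) :=
    is_ncfun f /\
    (forall j beta, (j <= k)%N -> (beta < d j)%N ->
       nc_eq (ddelta j beta f) (F j beta)) in
  ((exists f, antiderivative f) <->
   (forall i j alpha beta (le_ij : (i <= j)%N), (j <= k)%N ->
      (alpha < d i)%N -> (beta < d j)%N ->
      nc_eq (nc_cast (ins_ins R^o (slots k Om N) le_ij)
                     (ddelta i alpha (F j beta)))
            (ddelta j.+1 beta (F i alpha)))) /\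
  (forall f f' : ncfun (slots k Om N),
     antiderivative f -> antiderivative f' ->
     exists c : kmap_of (slots k Om N),
       is_klinear c /\ nc_eq f' (nc_add f (nc_const c))).
Proof.
(* Writing k as a successor exposes two slots, the shape in which [nc_const] is a path sum. *)
case: k F => // k F _ _ Om_nc F_nc; rewrite /=.
have sl_nc := nc_slots_slots N Om_nc.
have sd_slots j : (j <= k.+1)%N -> sdim (nth (slot0 R) (slots k.+1 Om N) j) = d j.
  by move=> le_j; rewrite nth_mkseq.
have size_slots : size (slots k.+1 Om N) = k.+2 by rewrite size_mkseq.
have F_nc' j b : (j < size (slots k.+1 Om N))%N ->
    (b < sdim (nth (slot0 R) (slots k.+1 Om N) j))%N -> is_ncfun (F j b).
  by rewrite size_slots ltnS => le_j; rewrite sd_slots //; apply: F_nc.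
have ltS j : (j < size (slots k.+1 Om N))%N = (j <= k.+1)%N.
  by rewrite size_slots ltnS.
have antiE f : nc_antiderivative F f <-> is_ncfun f /\
    (forall j beta, (j <= k.+1)%N -> (beta < d j)%N ->
       nc_eq (ddelta j beta f) (F j beta)).
  split=> -[f_nc fF]; split=> // j b lt_j lt_b.
    by apply: fF; rewrite ?ltS ?sd_slots.
  by move: lt_j lt_b; rewrite ltS => lt_j; rewrite sd_slots //; apply: fF.
split; last first.
  move=> f f' /antiE f_anti /antiE f'_anti.
  exact: nc_antiderivative_unique sl_nc f_anti f'_anti.
have [anti_closed closed_anti] := nc_antiderivativeP sl_nc F_nc'.
split=> [[f /antiE f_anti] i j a b le_ij le_j lt_a lt_b|F_closed].
  apply: anti_closed; rewrite ?ltS ?sd_slots //; first by exists f.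
  exact: leq_trans le_j.
have [|f /antiE f_anti] := closed_anti; last by exists f.
move=> i j a b le_ij; rewrite ltS => le_j.
by rewrite !sd_slots //; [apply: F_closed | apply: leq_trans le_j].
Qed.
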